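(* Up to isomorphism, there are exactly 19 minimal obstructions to $C_5$-coloring among $P_8$-free graphs.
   Context: All graphs are finite and simple. For graphs $G$ and $H$, an $H$-coloring of $G$ is a map $c: V(G)\to V(H)$ such that $c(u)c(v)\in E(H)$ for every edge $uv\in E(G)$. A graph $G$ is a minimal obstruction to $H$-coloring if $G$ has no $H$-coloring but every proper induced subgraph of $G$ has an $H$-coloring. $C_5$ is the cycle on five vertices, $P_t$ is the path on $t$ vertices, and a graph is $F$-free if it does not contain $F$ as an induced subgraph. *)

(* Defs.v *)
From HB Require Import structures.
From mathcomp Require Import all_boot.

Set Implicit Arguments.
Unset Strict Implicit.
Unset Printing Implicit Defensive.

Record sgraph := SGraph {
  vertex :> finType;
  edge : rel vertex;
  edge_sym : symmetric edge;
  edge_irrefl : irreflexive edge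
}.

Section Induced.
Variables (G : sgraph) (S : {set G}).

Definition induced_edge : rel {x : G | x \in S} :=
  fun x y => edge (val x) (val y).

Lemma induced_edge_sym : symmetric induced_edge.
Proof. by move=> x y; apply: edge_sym. Qed.

Lemma induced_edge_irrefl : irreflexive induced_edge.
Proof. by move=> x; apply: edge_irrefl. Qed.

Definition induced : sgraph := SGraph induced_edge_sym induced_edge_irrefl.
End Induced.

Definition isomorphic (G H : sgraph) : Prop :=
  exists2 f : G -> H, bijective f & forall u v : G, edge (f u) (f v) = edge u v.

Definition colorable (H G : sgraph) : Prop :=
  exists c : G -> H, forall u v : G, edge u v -> edge (c u) (c v).

Definition minimal_obstruction (H G : sgraph) : Prop :=
  ~ colorable H G /\
  forall S : {set G}, S \proper [set: G] -> colorable H (induced S).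

Definition free (F G : sgraph) : Prop :=
  ~ exists S : {set G}, isomorphic F (induced S).

Section Path.
Variable t : nat.

Definition path_edge : rel 'I_t := fun i j => (i.+1 == j) || (j.+1 == i).

Lemma path_edge_sym : symmetric path_edge.
Proof. by move=> i j; rewrite /path_edge orbC. Qed.

Lemma path_edge_irrefl : irreflexive path_edge.
Proof. by move=> i; rewrite /path_edge orbb gtn_eqF. Qed.

Definition path_graph : sgraph := SGraph path_edge_sym path_edge_irrefl.
End Path.

Definition C5_edge : rel 'I_5 := fun i j => (ordS i == j) || (ordS j == i).

Lemma C5_edge_sym : symmetric C5_edge.
Proof. by move=> i j; rewrite /C5_edge orbC. Qed.

Lemma C5_edge_irrefl : irreflexive C5_edge.
Proof. by case=> [[|[|[|[|[|]]]]] ?]. Qed.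

Definition C5 : sgraph := SGraph C5_edge_sym C5_edge_irrefl.

(* Main.v *)
(* Let G be a P8-free minimal obstruction other than the 19 listed graphs. It contains
   none of them as an induced subgraph: a proper induced subgraph of G is colorable.
   As G is not bipartite and P8-free, it contains an induced cycle of length 3, 5 or 7;
   the triangle is listed. The 5-cycle, then the 7-cycle, is refuted by a search tree
   whose nodes are induced subgraphs X of G, together with the possible neighborhoods in
   X (types) of the other vertices of G.

   The key step removes a nonempty set U of vertices of X. A coloring c of G - U exists
   by minimality. Suppose that every coloring of X - U can be extended to U so that each
   color a vertex of a remaining type may have under c is compatible with the colors
   chosen on U. Then c extends to G, a contradiction; hence at least one vertex of G has
   a type excluded from this test, and X can be enlarged by it. A type is discarded as
   soon as the enlarged graph contains a triangle, an induced P8, a listed graph, or a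
   graph refuted earlier in the search. *)
Require Import Defs.
From mathcomp Require Import all_boot zify.

Set Implicit Arguments.
Unset Strict Implicit.
Unset Printing Implicit Defensive.

(** The obstacle is that the size of [G] is unbounded and the edges between vertices outside [X] are
    unknown. The removal of [U] avoids both: outside [U] the coloring [c] is kept, so edges there
    stay properly colored, and only the finite list of types matters, not the number of vertices of
    each type. The simplest instance is a vertex [u] of [X] whose neighborhood in [G] lies within
    that of another vertex [v] of [X]: [u] can take the color of [v]. Larger sets [U] recolor
    several vertices at once. The search trees are explicit data. Neither they nor the 19 graphs are
    trusted: [check] is a computation on lists of bits, justified by [check_sound], and the graphs
    are tested separately. If [G] contains a listed graph, it is that graph: a copy that misses a
    vertex would lie in a colorable proper induced subgraph. That the 19 graphs are pairwise
    non-isomorphic follows from an invariant, the number of closed walks of length 6. *)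

(** * Codes of graphs *)

(* A code lists the vertices of a graph, newest first; each vertex is given by
   its adjacencies to the older ones. *)
Definition code := seq bitseq.

Fixpoint induced_code (T : Type) (e : rel T) (xs : seq T) : code :=
  if xs is x :: xs' then [seq e x y | y <- xs'] :: induced_code e xs' else [::].

(** Row [i] starts at vertex [i.+1], hence the offset. *)
Definition code_adj (X : code) (i j : nat) : bool :=
  if i < j then nth false (nth [::] X i) (j - i.+1)
  else if j < i then nth false (nth [::] X j) (i - j.+1)
  else false.

Definition is_copy (G : sgraph) (X : code) (xs : seq G) : bool :=
  uniq xs && (induced_code (@edge G) xs == X).

Definition avoids (G : sgraph) (X : code) : Prop := forall xs : seq G, ~~ is_copy X xs.

(** [m] gives the position in [X] of each vertex of [F], in the order of [F]. Equality of codes also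
    compares non-edges, so the embedding is induced. *)
Definition embeds_at (F X : code) (m : seq nat) : bool :=
  [&& uniq m, all (fun i => i < size X) m & induced_code (code_adj X) m == F].

Lemma code_adj_sym X : symmetric (code_adj X).
Proof. by move=> i j; rewrite /code_adj; case: ltngtP. Qed.

Lemma code_adj_irrefl X : irreflexive (code_adj X).
Proof. by move=> i; rewrite /code_adj ltnn. Qed.

Lemma size_induced_code (T : Type) (e : rel T) xs : size (induced_code e xs) = size xs.
Proof. by elim: xs => //= x xs ->. Qed.

Lemma nth_induced_code (T : Type) (e : rel T) x0 xs i j :
  i < j < size xs ->
  nth false (nth [::] (induced_code e xs) i) (j - i.+1) = e (nth x0 xs i) (nth x0 xs j).
Proof.
elim: xs i j => [|x xs IHxs] i j; first by rewrite andbF.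
case: i j => [|i] [|j] //=; first by rewrite subn1 => ?; rewrite (nth_map x0).
by rewrite !ltnS subSS; apply: IHxs.
Qed.

(** A code records only the pairs [i < j], so agreement on these is enough. This matters for
    relations that are not symmetric, as in [cycle_code]. *)
Lemma eq_induced_code (T U : Type) (e : rel T) (e' : rel U) (f : T -> U) xs :
  (forall i j, i < j < size xs -> forall x0,
     e' (f (nth x0 xs i)) (f (nth x0 xs j)) = e (nth x0 xs i) (nth x0 xs j)) ->
  induced_code e' (map f xs) = induced_code e xs.
Proof.
elim: xs => //= x xs IHxs fE; congr (_ :: _); last first.
  by apply: IHxs => i j ltij x0; apply: (fE i.+1 j.+1).
rewrite -map_comp; apply/(@eq_from_nth _ false); rewrite !size_map // => j ltj.
by rewrite !(nth_map x) //; apply: (fE 0 j.+1).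
Qed.

Section Copies.
Variable G : sgraph.
Implicit Types (X F : code) (xs : seq G).

Lemma is_copy_adj X xs x0 i j :
  is_copy X xs -> i < size X -> j < size X ->
  edge (nth x0 xs i) (nth x0 xs j) = code_adj X i j.
Proof.
case/andP=> _ /eqP <-; rewrite size_induced_code /code_adj => lti ltj.
case: ltngtP => [ltij|ltji|->]; last by rewrite edge_irrefl.
  by rewrite (nth_induced_code _ x0) // ltij.
by rewrite (nth_induced_code _ x0) ?ltji // edge_sym.
Qed.

Lemma is_copy_size X xs : is_copy X xs -> size xs = size X.
Proof. by case/andP=> _ /eqP <-; rewrite size_induced_code. Qed.

Lemma is_copy_embeds F X m xs : embeds_at F X m -> is_copy X xs ->
  exists ys : seq G, is_copy F ys.
Proof.
case/and3P=> m_uniq m_lt /eqP <- Xxs; have sz := is_copy_size Xxs.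
case: xs => [|x0 xs] in Xxs sz *.
  by case: m m_lt m_uniq => [|i m] /=; [exists [::] | rewrite -sz].
exists (map (nth x0 (x0 :: xs)) m); apply/andP; split.
  rewrite map_inj_in_uniq // => i j /(allP m_lt) lti /(allP m_lt) ltj /eqP.
  by rewrite nth_uniq ?sz // => [/eqP //|]; case/andP: Xxs.
apply/eqP/eq_induced_code => i j /andP [ltij ltj] y0.
have mem k : k < size m -> nth y0 m k < size X by move=> ?; apply/(allP m_lt)/mem_nth.
by rewrite (is_copy_adj _ Xxs) // mem // (ltn_trans ltij).
Qed.

Lemma avoids_embeds F X m : avoids G F -> embeds_at F X m -> avoids G X.
Proof.
by move=> noF FX xs; apply/negP => /(is_copy_embeds FX) [ys]; apply/negP.
Qed.
End Copies.
(** * Colorings *)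

Definition colors : seq nat := iota 0 5.

Definition color_adj (y z : nat) : bool :=
  nth false (nth [::]
    [:: [:: false; true; false; false; true];
        [:: true; false; true; false; false];
        [:: false; true; false; true; false];
        [:: false; false; true; false; true];
        [:: true; false; false; true; false]] y) z.

Lemma color_adj_sym : symmetric color_adj.
Proof.
move=> y z; rewrite /color_adj.
by case: y z => [|[|[|[|[|y]]]]] [|[|[|[|[|z]]]]]; rewrite /= ?nth_nil.
Qed.

Lemma color_adj_rot k y z : y < 5 -> z < 5 -> k < 5 ->
  color_adj ((y + k) %% 5) ((z + k) %% 5) = color_adj y z.
Proof.
by case: y z k => [|[|[|[|[|y]]]]] [|[|[|[|[|z]]]]] // [|[|[|[|[|k]]]]].
Qed.

Lemma C5_edgeE (i j : C5) : edge i j = color_adj i j.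
Proof. by case: i j => [[|[|[|[|[|i]]]]] ?] [[|[|[|[|[|j]]]]] ?]. Qed.

Definition proper_on (G : sgraph) (D : pred G) (c : G -> nat) : Prop :=
  forall x y, D x -> D y -> edge x y -> color_adj (c x) (c y).

(** [color_adj] is false beyond 4, so both ends of an edge have genuine colors; [inord] can only
    change the color of an isolated vertex. *)
Lemma colorable_proper (G : sgraph) (c : G -> nat) : proper_on predT c -> colorable C5 G.
Proof.
move=> c_ok; exists (fun x => inord (c x) : 'I_5) => x y /(c_ok x y isT isT).
rewrite C5_edgeE /=; case: (ltnP (c x) 5) => [ltx|gex]; last first.
  by rewrite /color_adj (nth_default [::]) ?nth_nil.
case: (ltnP (c y) 5) => [lty|gey]; first by rewrite !inordK.
by rewrite color_adj_sym /color_adj (nth_default [::]) ?nth_nil.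
Qed.

Lemma induced_colorable_proper (G : sgraph) (S : {set G}) :
  colorable C5 (induced S) -> exists2 c : G -> nat, (forall x, c x < 5) & proper_on (mem S) c.
Proof.
(* Vertices outside [S] get color 0, which [proper_on] ignores. *)
case=> c c_ok; exists (fun x => odflt ord0 (omap c (insub x)) : 'I_5) => [x //|x y].
rewrite !inE => Sx Sy xy; rewrite !insubT /= -C5_edgeE.
exact: (c_ok (Sub x Sx) (Sub y Sy)).
Qed.

(** Rotations of the 5-cycle act transitively on the colors. Pinning the color of one vertex divides
    the number of colorings to enumerate by five. *)
Lemma proper_on_rot (G : sgraph) (D : pred G) (c : G -> nat) z :
  (forall x, c x < 5) -> proper_on D c ->
  exists c', [/\ forall x, c' x < 5, proper_on D c' & c' z = 0].
Proof.
move=> c_lt c_ok; exists (fun x => (c x + (5 - c z) %% 5) %% 5); split=> [x|x y Dx Dy xy|].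
- by rewrite ltn_mod.
- by rewrite color_adj_rot ?ltn_mod // c_ok.
by rewrite modnDmr subnKC ?modnn // ltnW.
Qed.

(* [None] marks an uncolored vertex. *)
Fixpoint compatible (y : nat) (s : bitseq) (c : seq (option nat)) : bool :=
  match s, c with
  | b :: s', o :: c' =>
    if b then (if o is Some z then color_adj y z else true) && compatible y s' c'
    else compatible y s' c'
  | _, _ => true
  end.

(* All colorings that leave exactly the vertices in [u] uncolored, with the oldest
   vertex, if colored, of color 0. *)
Fixpoint partial_colorings (X : code) (u : bitseq) : seq (seq (option nat)) :=
  match X, u with
  | s :: X', b :: u' =>
    flatten [seq if b then [:: None :: c]
                 else [seq Some y :: c | y <- (if X' is [::] then [:: 0] else colors)
                                       & compatible y s c]
            | c <- partial_colorings X' u']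
  | _, _ => [:: [::]]
  end.

Fixpoint completions (X : code) (c : seq (option nat)) : seq (seq (option nat)) :=
  match X, c with
  | s :: X', o :: c' =>
    flatten [seq [seq Some y :: a | y <- (if o is Some y then [:: y] else colors)
                                  & compatible y s a]
            | a <- completions X' c']
  | _, _ => [:: [::]]
  end.

(** Rows of a code and types of outside vertices are both lists of adjacencies, so this covers both
    uses of [compatible]. *)
Lemma compatible_map (T : eqType) y (e : pred T) (o : T -> option nat) xs :
  compatible y (map e xs) (map o xs) =
  all (fun z => e z ==> if o z is Some k then color_adj y k else true) xs.
Proof. by elim: xs => //= x xs ->; case: (e x). Qed.

Section Colorings.
Variable G : sgraph.
Implicit Types (xs : seq G) (D : pred G) (c : G -> nat).

(** Completeness makes a test over the list cover every coloring of [G] minus [D], and makes an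
    empty list a proof of non-colorability. *)
Lemma partial_colorings_complete D c xs :
  (forall x, c x < 5) -> proper_on (predC D) c -> last 0 (map c xs) = 0 ->
  [seq if D x then None else Some (c x) | x <- xs]
    \in partial_colorings (induced_code (@edge G) xs) (map D xs).
Proof.
move=> c_lt c_ok; elim: xs => //= x xs IHxs c0.
apply/flatten_mapP; exists [seq if D x then None else Some (c x) | x <- xs].
  by apply: IHxs; case: (xs) c0 => //=.
case: ifPn => Dx; first by rewrite inE.
apply/mapP; exists (c x) => //; rewrite mem_filter compatible_map.
apply/andP; split; last by case: (xs) c0 => [/= ->|y ys _] //=; rewrite mem_iota c_lt.
apply/allP => z _; apply/implyP => xz; case: ifPn => // Dz; exact: c_ok.
Qed.

(** Soundness serves the minimality of the listed graphs: a computed list that is not empty yields a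
    coloring of the graph minus a vertex. *)
Lemma partial_colorings_sound D xs pc : uniq xs ->
  pc \in partial_colorings (induced_code (@edge G) xs) (map D xs) ->
  exists c, {in xs &, forall x y, ~~ D x -> ~~ D y -> edge x y -> color_adj (c x) (c y)} /\
    pc = [seq if D x then None else Some (c x) | x <- xs].
Proof.
elim: xs pc => [|x xs IHxs] pc /=; first by rewrite inE => _ /eqP ->; exists (fun=> 0).
case/andP=> x_xs xs_uniq /flatten_mapP [pc' /(IHxs _ xs_uniq) [c [c_ok ->]]] pc_in.
have [y pcE y_ok] : exists2 y, pc = (if D x then None else Some y) ::
     [seq if D x then None else Some (c x) | x <- xs] &
   D x \/ {in xs, forall z, edge x z -> ~~ D z -> color_adj y (c z)}.
  case: ifPn pc_in => Dx; first by rewrite inE => /eqP ->; exists 0 => //; left.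
  case/mapP=> y; rewrite mem_filter compatible_map => /andP [/allP y_ok _] ->.
  exists y => //; right=> z /y_ok; case: ifPn => // _ /implyP yz xz _; exact: yz.
pose c' z := if z == x then y else c z.
have c'x : c' x = y by rewrite /c' eqxx.
have c'E : {in xs, c' =1 c}.
  by move=> z z_xs; rewrite /c' (negPf (memPn x_xs z z_xs)).
exists c'; split; last first.
  by rewrite pcE c'x; congr (_ :: _); apply/eq_in_map => z z_xs; rewrite c'E.
move=> z w; rewrite !inE => /predU1P [->|z_xs] /predU1P [->|w_xs] Dz Dw.
- by rewrite edge_irrefl.
- by case: y_ok => [|y_ok xw]; [rewrite (negPf Dz) | rewrite c'x c'E // y_ok].
- case: y_ok => [|y_ok]; [by rewrite (negPf Dw) | rewrite edge_sym => xz].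
  by rewrite c'x c'E // color_adj_sym y_ok.
by rewrite !c'E //; apply: c_ok.
Qed.

Lemma completions_sound (o : G -> option nat) xs a : uniq xs ->
  a \in completions (induced_code (@edge G) xs) (map o xs) ->
  exists g : G -> nat, [/\ a = [seq Some (g x) | x <- xs],
    {in xs, forall x k, o x = Some k -> g x = k} &
    {in xs &, forall x y, edge x y -> color_adj (g x) (g y)}].
Proof.
elim: xs a => [|x xs IHxs] a /=; first by rewrite inE => _ /eqP ->; exists (fun=> 0).
case/andP=> x_xs xs_uniq /flatten_mapP [a' /(IHxs _ xs_uniq) [g [-> go g_ok]]].
case/mapP=> y; rewrite mem_filter (compatible_map _ _ (fun z => Some (g z))).
case/andP=> /allP y_ok y_o ->.
pose g' z := if z == x then y else g z.
have g'x : g' x = y by rewrite /g' eqxx.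
have g'E : {in xs, g' =1 g}.
  by move=> z z_xs; rewrite /g' (negPf (memPn x_xs z z_xs)).
exists g'; split.
- by rewrite g'x; congr (_ :: _); apply/eq_in_map => z z_xs; rewrite g'E.
- move=> z; rewrite inE => /predU1P [-> k ok|z_xs k]; last by rewrite g'E //; apply: go.
  by move: y_o; rewrite ok inE g'x => /eqP.
move=> z w; rewrite !inE => /predU1P [->|z_xs] /predU1P [->|w_xs].
- by rewrite edge_irrefl.
- by move=> xw; rewrite g'x g'E // (implyP (y_ok w w_xs)).
- by rewrite edge_sym => xz; rewrite g'x g'E // color_adj_sym (implyP (y_ok z z_xs)).
by rewrite !g'E //; apply: g_ok.
Qed.
End Colorings.
(** * Certificates *)

Fixpoint path_code (n : nat) : code :=
  if n is n'.+1 then mkseq (fun j => j == 0) n' :: path_code n' else [::].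

Fixpoint andb_seq (s t : bitseq) : bitseq :=
  match s, t with
  | b :: s', c :: t' => (b && c) :: andb_seq s' t'
  | _, _ => [::]
  end.

Fixpoint minus_seq (s t : bitseq) : bitseq :=
  match s, t with
  | b :: s', c :: t' => (if c then false else b) :: minus_seq s' t'
  | _, _ => [::]
  end.

Definition disjoint_seq (s t : bitseq) : bool := ~~ has id (andb_seq s t).

Fixpoint first_some (A : Type) (f : nat -> bitseq -> option A)
    (i : nat) (rows : seq bitseq) (mask : bitseq) : option A :=
  match rows, mask with
  | r :: rows', b :: mask' =>
    if b then (if f i r is Some x then Some x else first_some f i.+1 rows' mask')
    else first_some f i.+1 rows' mask'
  | _, _ => None
  end.

(* [find_path8 rows t] looks for an induced path on 8 vertices through a new vertex,
   of type [t] over the graph with adjacency matrix [rows]: a first arm of 4 to 7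
   vertices is grown from the new vertex, then a second one. The answer is only a
   guess, to be verified by [embeds_at]. *)
Section FindPath.
Variable rows : seq bitseq.

Fixpoint grow_arm (k : nat) (row allowed : bitseq) (p : seq nat) : option (seq nat) :=
  if k is k'.+1 then
    first_some (fun i r => grow_arm k' r (minus_seq allowed row) (i.+1 :: p))
      0 rows (andb_seq row allowed)
  else Some p.

Variable t : bitseq.

(** [len] counts the vertices of the first arm and [k] those still missing, so [k + len] is always 7
    and [k <= len] keeps the second arm from being the longer one. [allowed2] excludes the first arm
    and its neighbors. Positions are shifted by one because 0 is the new vertex. *)
Fixpoint grow_two_arms (k len : nat) (row allowed allowed2 : bitseq) (p : seq nat) :
    option (seq nat) :=
  if k is k'.+1 then
    let second_arm :=
      if k <= len then
        first_some (fun i r => grow_arm k' r (minus_seq allowed2 t) (i.+1 :: 0 :: rev p))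
          0 rows (andb_seq t allowed2)
      else None in
    if second_arm is Some q then Some q else
    first_some (fun i r => grow_two_arms k' len.+1 r (minus_seq allowed row)
                  (set_nth false (minus_seq allowed2 r) i false) (i.+1 :: p))
      0 rows (andb_seq row allowed)
  else Some (0 :: rev p).

Definition find_path8 : seq nat :=
  let full := nseq (size rows) true in
  odflt [::] (first_some (fun i r => grow_two_arms 6 1 r (minus_seq full t)
      (set_nth false (minus_seq full r) i false) [:: i.+1]) 0 rows t).
End FindPath.

Definition adj_rows (X : code) : seq bitseq :=
  let n := size X in [seq [seq code_adj X i j | j <- iota 0 n] | i <- iota 0 n].

(** A type over [s :: X] restricts to a type over [X], so only extensions of members of [T] are
    candidates, and types excluded higher in the tree stay excluded. *)
Definition extend_types (s : bitseq) (X : code) (T : seq bitseq) : seq bitseq :=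
  let X' := s :: X in
  let rows := adj_rows X' in
  [seq t <- flatten [seq (false :: t) :: (if disjoint_seq s t then [:: true :: t] else [::])
                    | t <- T]
  | ~~ embeds_at (path_code 8) (t :: X') (find_path8 rows t)].

Fixpoint all_types (X : code) : seq bitseq :=
  if X is s :: X' then extend_types s X' (all_types X') else [:: [::]].

Definition harmless (c a : seq (option nat)) (t : bitseq) : bool :=
  all (fun y => compatible y t c ==> compatible y t a) colors.

(** Vertices whose type misses [u] see no recolored vertex, so their types are dropped. [has id u]
    makes [G] minus [u] a proper induced subgraph, to which minimality applies. *)
Definition recolorable (X : code) (T : seq bitseq) (u : bitseq) : bool :=
  let T' := [seq t <- T | ~~ disjoint_seq u t] in
  has id u &&
  all (fun c => has (fun a => all (harmless c a) T') (completions X c))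
    (partial_colorings X u).

Definition bits (n : nat) (l : seq nat) : bitseq := mkseq (fun i => i \in l) n.

(* A refutation of the existence of an induced copy of [X] in [G], given a list [T]
   of all possible types of the vertices outside such a copy and a list [Fs] of
   graphs that are not induced subgraphs of [G]:
   - [Recolor l]: a coloring of [G] minus the vertices [l] extends to [G];
   - [Embed l k m c]: the type [l] is impossible, as [m] embeds [nth Fs k];
   - [Split l c1 c2]: the type [l] is impossible by [c1]; continue with [c2].
   Vertices are numbered newest first; an index [k] out of range denotes the path P8. *)
Inductive cert :=
| Recolor of seq nat
| Embed of seq nat & nat & seq nat & cert
| Split of seq nat & cert & cert.

(** A refuted graph goes to the front of [Fs], so the index of a given graph grows along a branch of
    the certificate. *)
Fixpoint check (X : code) (T : seq bitseq) (Fs : seq code) (c : cert) : bool :=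
  match c with
  | Recolor l => recolorable X T (bits (size X) l)
  | Embed l k m c' =>
    let s := bits (size X) l in
    embeds_at (nth (path_code 8) Fs k) (s :: X) m && check X [seq t <- T | t != s] Fs c'
  | Split l c1 c2 =>
    let s := bits (size X) l in
    check (s :: X) (extend_types s X T) Fs c1 &&
    check X [seq t <- T | t != s] ((s :: X) :: Fs) c2
  end.

Lemma disjoint_seqP (T : eqType) (d e : pred T) xs :
  reflect {in xs, forall x, d x -> e x -> False} (disjoint_seq (map d xs) (map e xs)).
Proof.
apply: (iffP idP) => [|de].
  rewrite /disjoint_seq; elim: xs => //= x xs IHxs; rewrite negb_or => /andP [xN /IHxs IH] z.
  by rewrite inE => /predU1P [-> dx ex|/IH //]; rewrite dx ex in xN.
rewrite /disjoint_seq; elim: xs de => //= x xs IHxs de; rewrite negb_or IHxs ?andbT.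
  by apply/negP => /andP [/(de x (mem_head _ _))].
by move=> z z_xs; apply: de; rewrite inE z_xs orbT.
Qed.

(** * Soundness of certificates *)

Section Soundness.
Variable G : sgraph.

(** No copy is fixed: the list serves all copies of [X] at once, so a type [s] may be deleted
    exactly by showing that [G] avoids [s :: X]. *)
Definition complete_types (X : code) (T : seq bitseq) : Prop :=
  forall xs : seq G, is_copy X xs ->
  forall w, w \notin xs -> [seq edge w x | x <- xs] \in T.

Lemma is_copy_cons (x : G) xs s X : is_copy (s :: X) (x :: xs) =
  [&& x \notin xs, [seq edge x y | y <- xs] == s & is_copy X xs].
Proof.
by rewrite /is_copy /= eqseq_cons; case: (x \in xs) => //=; case: (uniq xs); rewrite ?andbF.
Qed.

Lemma complete_types_avoid X T s : complete_types X T -> avoids G (s :: X) ->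
  complete_types X [seq t <- T | t != s].
Proof.
move=> TX noX xs Xxs w w_xs; rewrite mem_filter TX // andbT.
by apply: contra (noX (w :: xs)) => /eqP st; rewrite is_copy_cons w_xs st eqxx.
Qed.

Hypothesis no_path : avoids G (path_code 8).
Hypothesis no_triangle : forall x y z : G, edge x y -> edge y z -> edge x z -> False.

Lemma complete_extend_types s X T : complete_types X T ->
  complete_types (s :: X) (extend_types s X T).
Proof.
move=> TX [|x xs] // Xxs w; rewrite inE negb_or => /andP [wx w_xs].
have := Xxs; rewrite is_copy_cons => /and3P [x_xs /eqP sE Xxs'].
rewrite mem_filter; apply/andP; split.
  apply/negP => /(avoids_embeds no_path) /(_ (w :: x :: xs)) /negP; apply.
  by rewrite is_copy_cons inE negb_or wx w_xs Xxs eqxx.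
apply/flatten_mapP; exists [seq edge w y | y <- xs]; first exact: TX.
rewrite inE /=; case wx_edge: (edge w x); rewrite ?eqxx //=.
rewrite ifT ?inE // -sE; apply/disjoint_seqP => y _ xy wy.
by apply: (@no_triangle w x y).
Qed.

Lemma complete_all_types X : complete_types X (all_types X).
Proof.
elim: X => [|s X IHX] /=; last exact: complete_extend_types.
by move=> xs /is_copy_size /eqP; rewrite size_eq0 => /eqP -> w.
Qed.

Hypothesis not_colorable : ~ colorable C5 G.
Hypothesis colorable_proper_subset :
  forall S : {set G}, S \proper [set: G] -> colorable C5 (induced S).

(* The new coloring agrees with a coloring of [G] minus [u] outside the copy of [X]. *)
Lemma recolorable_avoids X T u : size u = size X -> complete_types X T ->
  recolorable X T u -> avoids G X.
Proof.
move=> u_sz TX /andP [/hasP [b b_u b_true] rec] xs; apply/negP => Xxs.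
have xs_sz := is_copy_size Xxs; have /andP [xs_uniq /eqP XE] := Xxs.
(* Outside [xs] the index is [size xs], where [nth] returns its default [false]; hence [D] lies
   inside the copy. *)
pose D (x : G) := nth false u (index x xs).
have uE : u = map D xs.
  apply: (@eq_from_nth _ false); first by rewrite size_map xs_sz.
  move=> i; rewrite u_sz -xs_sz => lti.
  case: xs xs_uniq lti @D {Xxs XE xs_sz} => // x0 xs xs_uniq lti D.
  by rewrite (nth_map x0) // /D index_uniq.
have D_xs x : D x -> x \in xs.
  by rewrite -index_mem xs_sz -u_sz ltnNge; apply: contraL => ?; rewrite /D nth_default.
have [z z_xs Dz] : exists2 z, z \in xs & D z.
  by move: b_u; rewrite uE => /mapP [z z_xs bE]; exists z => //; rewrite -bE.
have S_proper : [set x | ~~ D x] \proper [set: G].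
  by apply/properP; split; [exact: subsetT | exists z; rewrite ?inE ?Dz].
have [c0 c0_lt c0_ok] := induced_colorable_proper (colorable_proper_subset S_proper).
have [c [c_lt c_ok c_last]] := proper_on_rot (last z xs) c0_lt c0_ok.
have {}c_ok : proper_on (predC D) c by move=> x y Dx Dy; apply: c_ok; rewrite /= in_set.
have pc_in : [seq if D x then None else Some (c x) | x <- xs] \in partial_colorings X u.
  rewrite -XE uE; apply: partial_colorings_complete => //.
  by case: (xs) c_last z_xs => //= x ys; rewrite last_map.
have {rec} := allP rec _ pc_in; case/hasP=> a; rewrite -XE.
case/(completions_sound xs_uniq) => g [-> g_pc g_ok] /allP T_ok.
apply: not_colorable; apply: (@colorable_proper _ (fun x => if x \in xs then g x else c x)).
(* If the type of [w] misses [u], then [y] keeps its color under [c]; otherwise harmlessness of the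
   completion applies to the color of [w]. *)
have out_xs w y : w \notin xs -> y \in xs -> edge w y -> color_adj (c w) (g y).
  move=> w_xs y_xs wy; have Dw : ~~ D w by apply: contra w_xs; apply: D_xs.
  have [dis|ndis] := boolP (disjoint_seq u [seq edge w x | x <- xs]).
    have Dy : ~~ D y.
      by apply/negP => Dy; move: dis; rewrite uE => /disjoint_seqP /(_ y y_xs Dy wy).
    by rewrite (g_pc y y_xs (c y)) ?(negPf Dy) //; apply: c_ok.
  have : [seq edge w x | x <- xs] \in [seq t <- T | ~~ disjoint_seq u t].
    by rewrite mem_filter ndis TX.
  move/T_ok => /allP /(_ (c w)); rewrite mem_iota c_lt => /(_ isT) /implyP.
  rewrite !(compatible_map _ _ _ xs) => comp.
  (* The premise of harmlessness holds because [c] is proper between [w] and the vertices of the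
     copy outside [D]. *)
  suff /comp /allP /(_ y y_xs) : all (fun z => edge w z ==>
     (if (if D z then None else Some (c z)) is Some k then color_adj (c w) k else true)) xs.
    by rewrite wy.
  by apply/allP => x x_xs; apply/implyP => wx; case: ifPn => // Dx; apply: c_ok.
move=> x y _ _ xy; case: ifPn => x_xs; case: ifPn => y_xs.
- exact: g_ok.
- by rewrite color_adj_sym out_xs // edge_sym.
- exact: out_xs.
by apply: c_ok => //=; [apply: contra x_xs | apply: contra y_xs]; apply: D_xs.
Qed.

(** Refuting [s :: X] pays twice in a [Split]: it deletes the type [s] and adds a forbidden graph
    for the rest of the search. *)
Theorem check_sound X T Fs c : complete_types X T -> {in Fs, forall F, avoids G F} ->
  check X T Fs c -> avoids G X.
Proof.
elim: c X T Fs => [l|l k m c IHc|l c1 IH1 c2 IH2] X T Fs TX noFs /=.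
- by apply: recolorable_avoids; rewrite ?size_mkseq.
- case/andP=> emb; apply: IHc => //; apply: complete_types_avoid => //.
  apply: avoids_embeds emb; have [ltk|gek] := ltnP k (size Fs); first exact/noFs/mem_nth.
  by rewrite nth_default.
case/andP=> /(IH1 _ _ _ (complete_extend_types TX) noFs) noX.
apply: IH2 => [|F]; first exact: complete_types_avoid.
by rewrite inE => /predU1P [->|/noFs].
Qed.
End Soundness.
(** * The graph of a code *)

Section CodeGraph.
Variable X : code.

Definition code_graph_edge : rel 'I_(size X) := fun i j => code_adj X i j.

Lemma code_graph_sym : symmetric code_graph_edge.
Proof. by move=> i j; apply: code_adj_sym. Qed.

Lemma code_graph_irrefl : irreflexive code_graph_edge.
Proof. by move=> i; apply: code_adj_irrefl. Qed.

Definition code_graph : sgraph := SGraph code_graph_sym code_graph_irrefl.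
End CodeGraph.

Lemma isomorphic_sym G H : isomorphic G H -> isomorphic H G.
Proof.
case=> f [g fK gK] fE; exists g; first by exists f.
by move=> u v; rewrite -{2}(gK u) -{2}(gK v) fE.
Qed.

Lemma isomorphic_trans G H K : isomorphic G H -> isomorphic H K -> isomorphic G K.
Proof.
case=> f f_bij fE [g g_bij gE]; exists (g \o f); first exact: bij_comp.
by move=> u v; rewrite /= gE fE.
Qed.

(** Applied with [val] to an induced subgraph, and with [id] when the copy fills [G]. *)
Lemma copy_isomorphic (H G : sgraph) (h : H -> G) X xs :
  is_copy X xs -> injective h -> (forall u v, edge (h u) (h v) = edge u v) ->
  xs =i codom h -> isomorphic H (code_graph X).
Proof.
move=> Xxs h_inj hE xsE; have sz := is_copy_size Xxs; have /andP [xs_uniq _] := Xxs.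
have lt u : index (h u) xs < size X by rewrite -sz index_mem xsE codom_f.
exists (fun u => Ordinal (lt u) : code_graph X) => [|u v].
  apply: inj_card_bij => [u v [/(congr1 (nth (h u) xs))]|].
    by rewrite !nth_index ?xsE ?codom_f // => /h_inj.
  rewrite card_ord -sz -(size_codom h); apply: uniq_leq_size => // x.
  by rewrite xsE.
rewrite -hE /= /code_graph_edge /= -(is_copy_adj (h u) Xxs) ?lt //.
by rewrite !nth_index ?xsE ?codom_f.
Qed.

(** Embedding [X] in itself by the identity is the well-formedness test: it fails if a row has the
    wrong length. *)
Lemma is_copy_code_graph X : embeds_at X X (iota 0 (size X)) ->
  is_copy X (enum 'I_(size X) : seq (code_graph X)).
Proof.
case/and3P=> _ _ /eqP XE; rewrite /is_copy enum_uniq; apply/eqP.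
by rewrite -[RHS]XE -val_enum_ord; apply/esym/eq_induced_code.
Qed.

Lemma path_graph_isomorphic : isomorphic (path_graph 8) (code_graph (path_code 8)).
Proof.
exists id; first by exists id.
have adjE : all (fun i => all (fun j =>
   code_adj (path_code 8) i j == ((i.+1 == j) || (j.+1 == i))) (iota 0 8)) (iota 0 8) by [].
move=> u v; move/allP/(_ u): adjE; rewrite mem_iota ltn_ord => /(_ isT).
by move/allP/(_ v); rewrite mem_iota ltn_ord => /(_ isT) /eqP.
Qed.

Lemma free_path_avoids G : free (path_graph 8) G -> avoids G (path_code 8).
Proof.
move=> G_free xs; apply/negP => Pxs; apply: G_free; exists [set x in xs].
apply: isomorphic_trans path_graph_isomorphic (isomorphic_sym _).
apply: (@copy_isomorphic (induced [set x in xs]) G val _ _ Pxs) => // [|x].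
  exact: val_inj.
apply/idP/codomP => [x_xs|[y ->]]; last by have := valP y; rewrite inE.
have Sx : x \in [set x in xs] by rewrite inE.
by exists (Sub x Sx).
Qed.

Lemma avoids_free_path G : avoids G (path_code 8) -> free (path_graph 8) G.
Proof.
move=> noP [S [f f_bij fE]]; pose xs := [seq val (f i) | i <- enum 'I_8].
have /negP := noP xs; apply; apply/andP; split.
  by rewrite map_inj_uniq ?enum_uniq // => i j /val_inj /(bij_inj f_bij).
have -> : path_code 8 =
  induced_code (fun i j => (i.+1 == j) || (j.+1 == i)) (map val (enum 'I_8)).
  by rewrite val_enum_ord.
rewrite (@eq_induced_code _ _ (@edge (path_graph 8))) => [|i j _ x0]; last exact: fE.
by apply/eqP/esym/eq_induced_code.
Qed.

(** * Tests on a code: induced paths, colorability, minimality *)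

(* The [if] keeps [vm_compute] from evaluating the recursive call of a failed test. *)
Fixpoint extends_path (X : code) (k : nat) (p : seq nat) : bool :=
  if k is k'.+1 then
    has (fun v =>
           if ([seq code_adj X v j | j <- p] == mkseq (fun j => j == 0) (size p)) && (v \notin p)
           then extends_path X k' (v :: p) else false) (iota 0 (size X))
  else true.

(** Every suffix of a path code is a path code, so the path can be grown at its head, one vertex at
    a time; the induction peels [q] from its end. *)
Lemma extends_path_complete X p q :
  uniq (q ++ p) -> all (fun i => i < size X) q ->
  induced_code (code_adj X) (q ++ p) = path_code (size (q ++ p)) ->
  extends_path X (size q) p.
Proof.
elim/last_ind: q p => // q v IHq p; rewrite cat_rcons all_rcons size_rcons => uq /andP [ltv ltq] cE.
apply/hasP; exists v; first by rewrite mem_iota.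
rewrite ifT; first exact: IHq.
apply/andP; split.
  have : induced_code (code_adj X) (v :: p) = path_code (size (v :: p)).
    by elim: q cE {IHq uq ltq} => //= w q IHq [_ /IHq].
  by case=> ->.
by move: uq; rewrite cat_uniq /= => /and4P [].
Qed.

Lemma code_graph_avoids_path X :
  ~~ extends_path X 8 [::] -> avoids (code_graph X) (path_code 8).
Proof.
move=> noP xs; apply/negP => Pxs; have /= sz := is_copy_size Pxs.
case/andP: Pxs => xs_uniq /eqP cE; have sz' : size (map val xs) = 8 by rewrite size_map.
have : extends_path X (size (map val xs)) [::].
  apply: extends_path_complete; rewrite ?cats0.
  - by rewrite map_inj_uniq //; apply: val_inj.
  - by apply/allP => _ /mapP [i _ ->]; apply: ltn_ord.
  by rewrite sz' -cE; apply: eq_induced_code.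
by rewrite sz' (negPf noP).
Qed.

(** Colorings restrict to induced subgraphs, so it suffices to delete single vertices. *)
Definition is_minimal_code (X : code) : bool :=
  nilp (partial_colorings X (nseq (size X) false)) &&
  all (fun v => ~~ nilp (partial_colorings X (mkseq (fun i => i == v) (size X))))
    (iota 0 (size X)).

Lemma copy_not_proper (G : sgraph) X (xs : seq G) (c : G -> nat) :
  nilp (partial_colorings X (nseq (size X) false)) -> is_copy X xs ->
  (forall x, c x < 5) -> ~ proper_on (mem xs) c.
Proof.
move=> /nilP noc Xxs c_lt c_ok; have sz := is_copy_size Xxs; have /andP [_ /eqP XE] := Xxs.
case: xs => [|x xs] in c_ok Xxs sz XE *; first by rewrite -sz -XE in noc.
have {c_lt c_ok} [c' [c_lt c_ok c_last]] := proper_on_rot (last x xs) c_lt c_ok.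
(* With this choice no vertex of the copy counts as uncolored, while [c'] is proper on the
   complement of [D]. *)
pose D (y : G) := y \notin x :: xs.
have: [seq if D y then None else Some (c' y) | y <- x :: xs]
    \in partial_colorings X (map D (x :: xs)).
  rewrite -XE; apply: partial_colorings_complete => //; last by rewrite /= last_map.
  by move=> y z Dy Dz; apply: c_ok; apply: negbNE.
suff -> : map D (x :: xs) = nseq (size X) false by rewrite noc.
rewrite -sz; apply/(@eq_from_nth _ false); rewrite ?size_nseq ?size_map // => i lti.
by rewrite nth_nseq lti (nth_map x) // /D mem_nth.
Qed.

(** A copy missing a vertex would span a subset of a proper vertex set, which minimality of [G]
    colors. *)
Lemma copy_minimal_full (G : sgraph) X (xs : seq G) :
  nilp (partial_colorings X (nseq (size X) false)) -> is_copy X xs ->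
  (forall S : {set G}, S \proper [set: G] -> colorable C5 (induced S)) ->
  forall x, x \in xs.
Proof.
move=> noc Xxs G_min x; apply/negPn/negP => x_xs.
have S_proper : [set y in xs] \proper [set: G].
  by apply/properP; split; [exact: subsetT | exists x; rewrite ?inE].
have [c c_lt c_ok] := induced_colorable_proper (G_min _ S_proper).
apply: (copy_not_proper noc Xxs c_lt) => y z y_xs z_xs.
by apply: c_ok; rewrite /= in_set.
Qed.

Lemma is_minimal_code_obstruction X :
  embeds_at X X (iota 0 (size X)) -> is_minimal_code X ->
  minimal_obstruction C5 (code_graph X).
Proof.
move=> /is_copy_code_graph Xxs /andP [noc /allP minc]; split=> [[c c_ok]|S].
  apply: (@copy_not_proper (code_graph X) _ _ (fun x => val (c x : 'I_5)) noc Xxs) => [x|x y _ _].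
    exact: ltn_ord.
  by move/c_ok; rewrite C5_edgeE.
(* A coloring of the graph minus one vertex [v] outside [S] restricts to [S]. *)
case/properP=> _ [v _ vS]; have := minc v; rewrite mem_iota ltn_ord => /(_ isT).
case pcE: (partial_colorings _ _) => [|pc pcs] // _.
have: pc \in partial_colorings (induced_code (@edge (code_graph X)) (enum 'I_(size X)))
    (map (pred1 v) (enum 'I_(size X))).
  case/andP: Xxs => _ /eqP ->; suff <- : mkseq (fun i => i == v) (size X) =
      map (pred1 v) (enum 'I_(size X)) by rewrite pcE mem_head.
  by rewrite /mkseq -val_enum_ord -map_comp.
case/partial_colorings_sound; first exact: enum_uniq.
move=> c [c_ok _]; apply: (@colorable_proper (induced S) (fun x => c (val x))) => x y _ _ xy.
have ne (z : induced S) : val z != v by apply: contraNneq vS => <-; apply: valP.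
by apply: c_ok => //; rewrite ?mem_enum ?ne.
Qed.

(** * Closed walks *)

Fixpoint walks (G : sgraph) (k : nat) (x y : G) : nat :=
  if k is k'.+1 then \sum_(z | edge x z) walks k' z y else x == y.

(** The trace of the [k]-th power of the adjacency matrix. *)
Definition closed_walks (G : sgraph) (k : nat) : nat := \sum_(x : G) walks k x x.

Lemma isomorphic_closed_walks G H k : isomorphic G H -> closed_walks G k = closed_walks H k.
Proof.
case=> f f_bij fE; have walksE j x y : walks j (f x) (f y) = walks j x y.
  elim: j x => [|j IHj] x /=; first by rewrite (bij_eq f_bij).
  rewrite (reindex f) /=; last exact: onW_bij.
  by apply: eq_big => z; rewrite ?fE.
rewrite /closed_walks [RHS](reindex f) /=; last exact: onW_bij.
by apply: eq_bigr => x _; rewrite walksE.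
Qed.

(** Multiplication by the adjacency matrix; [rows] is bound outside the function so that it is
    computed once for all iterations. *)
Definition walk_step (X : code) : seq nat -> seq nat :=
  let rows := adj_rows X in fun v => [seq sumn (mask r v) | r <- rows].

Definition code_closed_walks (k : nat) (X : code) : nat :=
  let step := walk_step X in
  sumn [seq nth 0 (iter k step (mkseq (fun i => (i == j) : nat) (size X))) j
       | j <- iota 0 (size X)].

Lemma sumn_mask (v : seq nat) (m : bitseq) n : size v = n ->
  sumn (mask m v) = \sum_(z < n | nth false m z) nth 0 v z.
Proof.
move=> <-; rewrite sumnE big_mask; apply: eq_big => z; rewrite ?andbT //.
by rewrite (tnth_nth 0).
Qed.

Lemma code_closed_walksE k X : code_closed_walks k X = closed_walks (code_graph X) k.
Proof.
rewrite /code_closed_walks /closed_walks; set n := size X; set step := walk_step X.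
have sz_rows : size (adj_rows X) = n by rewrite size_map size_iota.
have sz j i : size (iter j step (mkseq (fun l => (l == i) : nat) n)) = n.
  by case: j => [|j] /=; rewrite ?size_mkseq // size_map.
have walkE j (x y : code_graph X) :
    nth 0 (iter j step (mkseq (fun l => (l == y) : nat) n)) x = walks j x y.
  elim: j x => [|j IHj] x /=; first by rewrite nth_mkseq.
  rewrite (nth_map [::]) ?sz_rows // (@sumn_mask _ _ n) //.
  apply: eq_big => [z|z _]; last exact: IHj.
  by rewrite (nth_map 0) ?size_iota // nth_iota // (nth_map 0) ?size_iota // nth_iota.
have -> : iota 0 n = index_iota 0 n by rewrite /index_iota subn0.
rewrite sumnE big_map big_mkord.
by apply: eq_bigr => x _; rewrite walkE.
Qed.
(** * Short odd cycles *)

(** Only pairs [i < j] are recorded, so the closing edge appears as the pair of 0 and [n.-1]. *)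
Definition cycle_code (n : nat) : code :=
  induced_code (fun i j => (i.+1 == j) || (i == 0) && (j == n.-1)) (iota 0 n).

Section OddCycle.
Variable G : sgraph.

Definition closed_walk (n : nat) (w : nat -> G) : Prop :=
  w n = w 0 /\ forall i, i < n -> edge (w i) (w i.+1).

(* The double cover of [G]: an odd closed walk at [x] joins the two lifts of [x]. *)
Definition cover_edge : rel (G * bool) := fun u v => edge u.1 v.1 && (v.2 == ~~ u.2).

Lemma cover_connect_sym : connect_sym cover_edge.
Proof.
apply: sym_connect_sym => -[x b] [y c]; rewrite /cover_edge /= edge_sym.
by case: b c => [] [].
Qed.

Lemma cover_connect_walk x : connect cover_edge (x, false) (x, true) ->
  exists n w, odd n /\ closed_walk n w.
Proof.
case/connectP=> p p_path p_last.
pose u i := nth (x, false) ((x, false) :: p) i.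
have u_edge i : i < size p -> cover_edge (u i) (u i.+1) by apply: (pathP _ p_path).
have u_last : u (size p) = (x, true) by rewrite /u nth_last.
(* Each step in the cover flips the second coordinate, which therefore records parity. *)
have u_odd i : i <= size p -> (u i).2 = odd i.
  elim: i => //= i IHi lti; have /andP [_ /eqP ->] := u_edge i lti.
  by rewrite IHi // ltnW.
exists (size p), (fun i => (u i).1); split; first by rewrite -u_odd // u_last.
by split=> [|i /u_edge /andP []]; rewrite ?u_last.
Qed.

(** If the two lifts of a vertex are never joined, exactly one of them is reached from the lift of
    the root of its component. This gives a proper 2-coloring, and the colors 0 and 1 are adjacent
    in the 5-cycle. *)
Lemma odd_closed_walk : ~ colorable C5 G -> exists n w, odd n /\ closed_walk n w.
Proof.
move=> G_nc; have [/existsP [x]|] := boolP [exists x, connect cover_edge (x, false) (x, true)].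
  exact: cover_connect_walk.
rewrite negb_exists => /forallP no_odd; case: G_nc.
pose r (x : G) := root (@edge G) x.
have edge_csym : connect_sym (@edge G) by apply: sym_connect_sym; apply: edge_sym.
have lift_path a p : path (@edge G) a p ->
    exists b, connect cover_edge (a, false) (last a p, b).
  elim/last_ind: p => [|p z IHp]; first by exists false.
  rewrite rcons_path last_rcons => /andP [/IHp [b ab] lz].
  by exists (~~ b); apply: connect_trans ab (connect1 _); rewrite /cover_edge /= lz eqxx.
have lift x : exists b, connect cover_edge (r x, false) (x, b).
  have: connect (@edge G) (r x) x by rewrite edge_csym connect_root.
  by case/connectP=> p /lift_path [b rb] xE; exists b; rewrite -xE in rb.
pose c x := connect cover_edge (r x, false) (x, true).
have cE x b : connect cover_edge (r x, false) (x, b) -> c x = b.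
  case: b => //; rewrite cover_connect_sym => xr; apply/negbTE/negP => rx.
  by case/negP: (no_odd x); apply: connect_trans xr rx.
apply: (@colorable_proper _ (fun x => c x : nat)) => x y _ _ xy.
have [b xb] := lift x; rewrite (cE _ _ xb) (cE y (~~ b)); first by case: (b).
have <- : r x = r y by apply/eqP; rewrite root_connect // connect1.
by apply: connect_trans xb (connect1 _); rewrite /cover_edge /= xy eqxx.
Qed.

(* A repeated vertex or a chord splits an odd closed walk into two shorter closed
   walks, one of which is odd. *)
Lemma closed_walk_repeat n w i j : odd n -> closed_walk n w -> i < j < n -> w i = w j ->
  exists m w', [/\ m < n, odd m & closed_walk m w'].
Proof.
move=> n_odd [w_n w_edge] /andP [ltij ltjn] wij.
(* The two parts have lengths [j - i] and [n - (j - i)], with odd sum [n]. *)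
have [d_odd|d_even] := boolP (odd (j - i)).
  exists (j - i), (fun k => w (i + k)); split=> //; first by lia.
  split=> [|k ltk]; first by rewrite addn0 subnKC // ltnW.
  by rewrite addnS; apply: w_edge; lia.
exists (n - (j - i)), (fun k => if k <= i then w k else w (k + (j - i))); split; [lia|lia|].
split=> [|k ltk].
  by rewrite leq0n ifF; [rewrite subnK //; lia | lia].
case: (ltngtP k i) => [ltki|ltik|eki].
- by apply: w_edge; lia.
- by rewrite addSn; apply: w_edge; lia.
by rewrite eki wij addSn subnKC 1?ltnW //; apply: w_edge.
Qed.

Lemma closed_walk_chord n w i j : odd n -> closed_walk n w -> i < j < n ->
  edge (w i) (w j) -> ~~ ((i.+1 == j) || (i == 0) && (j == n.-1)) ->
  exists m w', [/\ m < n, odd m & closed_walk m w'].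
Proof.
move=> n_odd [w_n w_edge] /andP [ltij ltjn] wij nadj.
(* Each part uses the chord once, so the lengths add up to [n + 2], which is odd. Both parts are
   shorter than [n] since [nadj] excludes [j = i.+1] and the closing pair. *)
have [d_odd|d_even] := boolP (odd (j - i).+1).
  exists (j - i).+1, (fun k => if k <= j - i then w (i + k) else w i); split=> //; first by lia.
  split=> [|k ltk]; first by rewrite ltnn addn0.
  rewrite -ltnS ltk; case: (ltnP k (j - i)) => ltk'; first by rewrite addnS; apply: w_edge; lia.
  have -> : i + k = j by lia.
  by rewrite edge_sym.
(* The chord replaces the segment from [i] to [j]; [k.-1] accounts for the step along it. *)
exists (n - (j - i)).+1, (fun k => if k <= i then w k else w (k.-1 + (j - i))).
split; [lia|lia|split=> [|k ltk]].
  by rewrite leq0n ifF; [rewrite /= subnK //; lia | lia].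
case: (ltngtP k i) => [ltki|ltik|eki] /=.
- by apply: w_edge; lia.
- have -> : k + (j - i) = (k.-1 + (j - i)).+1 by lia.
  by apply: w_edge; lia.
by rewrite eki subnKC 1?ltnW.
Qed.

(** Stated for a prefix of length [k] to give both the cycle, with [k = n], and an induced path on 8
    vertices when the cycle is longer. *)
Lemma is_copy_cycle n w k : closed_walk n w -> k <= n ->
  (forall i j, i < j < n ->
     (w i != w j) && (edge (w i) (w j) ==> (i.+1 == j) || (i == 0) && (j == n.-1))) ->
  is_copy (induced_code (fun i j => (i.+1 == j) || (i == 0) && (j == n.-1)) (iota 0 k))
    (map w (iota 0 k)).
Proof.
move=> [w_n w_edge] lekn w_ind; apply/andP; split.
  rewrite map_inj_in_uniq ?iota_uniq // => i j; rewrite !mem_iota => lti ltj wij.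
  case: (ltngtP i j) => // ltij.
    by have := w_ind i j ltac:(lia); rewrite wij eqxx.
  by have := w_ind j i ltac:(lia); rewrite wij eqxx.
apply/eqP/eq_induced_code => i j; rewrite size_iota => /andP [ltij ltj] x0.
rewrite !nth_iota ?add0n //; last by lia.
have /andP [_ /implyP ind] := w_ind i j ltac:(lia); apply/idP/idP => //.
case/orP => [/eqP <-|/andP [/eqP -> /eqP ->]]; first by apply: w_edge; lia.
rewrite edge_sym -w_n; have := w_edge n.-1; rewrite prednK; last by lia.
by apply; lia.
Qed.

(** A shortest odd closed walk has no repetition and no chord, so it is an induced cycle; length 9
    or more leaves room for the path. *)
Lemma short_odd_cycle : ~ colorable C5 G ->
  exists2 X, X \in [:: path_code 8; cycle_code 3; cycle_code 5; cycle_code 7] &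
    exists xs : seq G, is_copy X xs.
Proof.
case/odd_closed_walk=> n [w]; elim/ltn_ind: n w => n IHn w [n_odd w_cw].
have shorter : (exists m w', [/\ m < n, odd m & closed_walk m w']) ->
    exists2 X, X \in [:: path_code 8; cycle_code 3; cycle_code 5; cycle_code 7] &
    exists xs : seq G, is_copy X xs.
  by case=> m [w' [ltm m_odd w'_cw]]; apply: (IHn m ltm w').
pose adj i j := (i.+1 == j) || (i == 0) && (j == n.-1).
have [/'forall_forallP w_ind|] := boolP [forall i : 'I_n, forall j : 'I_n,
   (i < j) ==> (w i != w j) && (edge (w i) (w j) ==> adj i j)]; last first.
  rewrite negb_forall => /existsP [i]; rewrite negb_forall => /existsP [j].
  rewrite negb_imply negb_and negbK negb_imply => /andP [ltij].
  case/orP => [/eqP wij|/andP [wij nadj]]; apply: shorter.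
    by apply: (@closed_walk_repeat n w i j); rewrite // ltij ltn_ord.
  by apply: (@closed_walk_chord n w i j); rewrite // ltij ltn_ord.
have {w_ind} w_ind i j : i < j < n ->
    (w i != w j) && (edge (w i) (w j) ==> (i.+1 == j) || (i == 0) && (j == n.-1)).
  case/andP=> ltij ltj.
  exact: (implyP (w_ind (Ordinal (ltn_trans ltij ltj)) (Ordinal ltj)) ltij).
have [le8|gt8] := leqP 8 n.
  exists (path_code 8); first exact: mem_head.
  exists (map w (iota 0 8)); have := is_copy_cycle w_cw le8 w_ind.
  (* As [n] is odd, it is at least 9, and [n.-1] lies beyond the first 8 positions; written this
     way, the closing test computes to [false]. *)
  suff -> : n.-1 = (n - 9).+4.+4 by [].
  lia.
case: n => [|[|[|[|[|[|[|[|n]]]]]]]] // in n_odd w_cw w_ind gt8 {adj IHn shorter} *.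
- by case: w_cw => w1 /(_ 0 isT); rewrite w1 edge_irrefl.
- by exists (cycle_code 3); rewrite ?inE ?eqxx //; exists (map w (iota 0 3)); apply: is_copy_cycle.
- by exists (cycle_code 5); rewrite ?inE ?eqxx ?orbT //;
    exists (map w (iota 0 5)); apply: is_copy_cycle.
by exists (cycle_code 7); rewrite ?inE ?eqxx ?orbT //;
    exists (map w (iota 0 7)); apply: is_copy_cycle.
Qed.
End OddCycle.

(** * The obstructions and the search *)

(* Row [i] lists the neighbors of vertex [i] among the vertices that follow it,
   counted from [0]. *)
Definition mk_code (l : seq (seq nat)) : code :=
  let n := size l in [seq bits (n - i.+1) (nth [::] l i) | i <- iota 0 n].

(** The first graph is the triangle. In each of the others the five oldest vertices form a 5-cycle,
    so all of these appear in the search that starts from the 5-cycle. *)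
Definition obstruction_codes : seq code := [seq mk_code l | l <- [::
  [:: [:: 0; 1]; [:: 0]; [::]];
  [:: [:: 1; 3]; [:: 0; 3]; [:: 4]; [:: 0; 3]; [:: 0]; [:: 0]; [:: 0]; [::]];
  [:: [:: 0; 1]; [:: 4]; [:: 2; 4]; [:: 0; 3]; [:: 0]; [:: 0]; [:: 0]; [::]];
  [:: [:: 0; 1; 2]; [:: 2; 4]; [:: 2; 4]; [:: 0; 3]; [:: 0]; [:: 0]; [:: 0]; [::]];
  [:: [:: 0; 1]; [:: 2; 4]; [:: 2; 4]; [:: 0; 3]; [:: 0]; [:: 0]; [:: 0]; [::]];
  [:: [:: 0; 1]; [:: 3]; [:: 0; 3]; [:: 4]; [:: 0; 3]; [:: 0]; [:: 0]; [:: 0]; [::]];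
  [:: [:: 0; 2]; [:: 4]; [:: 0; 5]; [:: 0]; [:: 4]; [:: 0; 3]; [:: 0]; [:: 0]; [:: 0]; [::]];
  [:: [:: 0; 1; 10]; [:: 1; 4; 8]; [:: 1; 2; 9]; [:: 1; 5]; [:: 1; 3]; [:: 1; 2]; [:: 2; 4];
     [:: 2; 4]; [:: 0; 3]; [:: 0]; [:: 0]; [:: 0]; [::]];
  [:: [:: 0; 1; 6; 10]; [:: 1; 4; 8]; [:: 1; 2; 9]; [:: 1; 5]; [:: 1; 3]; [:: 1; 2];
     [:: 2; 4]; [:: 2; 4]; [:: 0; 3]; [:: 0]; [:: 0]; [:: 0]; [::]];
  [:: [:: 0; 1; 6; 10]; [:: 1; 4; 8]; [:: 1; 2; 9]; [:: 0; 1; 5]; [:: 1; 3]; [:: 1; 2];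
     [:: 2; 4]; [:: 2; 4]; [:: 0; 3]; [:: 0]; [:: 0]; [:: 0]; [::]];
  [:: [:: 0; 1]; [:: 1; 4; 8]; [:: 1; 2; 9]; [:: 1; 5]; [:: 1; 3]; [:: 1; 2]; [:: 2; 4];
     [:: 2; 4]; [:: 0; 3]; [:: 0]; [:: 0]; [:: 0]; [::]];
  [:: [:: 0; 1]; [:: 1; 4; 8]; [:: 1; 2; 9]; [:: 0; 1; 5]; [:: 1; 3]; [:: 1; 2]; [:: 2; 4];
     [:: 2; 4]; [:: 0; 3]; [:: 0]; [:: 0]; [:: 0]; [::]];
  [:: [:: 0; 1]; [:: 1; 4; 8]; [:: 1; 2; 9]; [:: 0; 1]; [:: 1]; [:: 1; 2]; [:: 2; 4];
     [:: 2; 4]; [:: 0; 3]; [:: 0]; [:: 0]; [:: 0]; [::]];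
  [:: [:: 0; 1; 3]; [:: 5]; [:: 2; 9]; [:: 0; 1]; [:: 1; 4]; [:: 1]; [:: 4]; [:: 2; 4];
     [:: 0; 3]; [:: 0]; [:: 0]; [:: 0]; [::]];
  [:: [:: 0; 1; 5; 9]; [:: 2; 3]; [:: 0; 4; 8]; [:: 0; 1]; [:: 1; 3]; [:: 1; 2]; [:: 2; 4];
     [:: 2; 4]; [:: 0; 3]; [:: 0]; [:: 0]; [:: 0]; [::]];
  [:: [:: 0; 1]; [:: 2; 3; 7]; [:: 0; 4; 8]; [:: 0; 1]; [:: 1; 3]; [:: 1; 2]; [:: 2; 4];
     [:: 2; 4]; [:: 0; 3]; [:: 0]; [:: 0]; [:: 0]; [::]];
  [:: [:: 0; 5]; [:: 0; 3]; [:: 1; 4; 8]; [:: 0; 1]; [:: 1]; [:: 1; 2]; [:: 2; 4]; [:: 2; 4];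
     [:: 0; 3]; [:: 0]; [:: 0]; [:: 0]; [::]];
  [:: [:: 0; 1; 6; 10]; [:: 1]; [:: 1]; [:: 0; 1; 5]; [:: 1; 3]; [:: 1; 2]; [:: 2; 4];
     [:: 2; 4]; [:: 0; 3]; [:: 0]; [:: 0]; [:: 0]; [::]];
  [:: [:: 0; 3; 4]; [:: 0; 4; 8]; [:: 0; 4]; [:: 0; 1]; [:: 1; 3]; [:: 1; 2]; [:: 2; 4];
     [:: 2; 4]; [:: 0; 3]; [:: 0]; [:: 0]; [:: 0]; [::]]]].

Definition C5_cert : cert :=
  Split [:: 2; 4] (Split [:: 2; 4] (Embed [:: 0; 1; 2] 3 [:: 4; 5; 3; 1; 6; 7; 2; 0] (Embed
  [:: 0; 1] 4 [:: 3; 4; 7; 0; 1; 6; 5; 2] (Split [:: 1; 3] (Embed [:: 0; 3; 6] 3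
  [:: 5; 6; 4; 1; 3; 8; 7; 0] (Embed [:: 0; 6] 1 [:: 4; 3; 8; 2; 5; 1; 0; 7] (Split [:: 5; 7]
  (Embed [:: 0; 2; 4] 3 [:: 9; 8; 5; 1; 7; 6; 3; 0] (Embed [:: 0; 1; 4] 3
  [:: 9; 4; 5; 1; 7; 6; 2; 0] (Embed [:: 0; 2] 4 [:: 5; 9; 6; 0; 1; 7; 8; 3] (Embed [:: 0; 1] 4
  [:: 5; 9; 6; 0; 1; 7; 4; 2] (Split [:: 2; 8] (Embed [:: 0; 2; 5; 7] 3
  [:: 10; 9; 6; 1; 4; 7; 8; 0] (Embed [:: 0; 5; 7] 3 [:: 10; 9; 6; 1; 4; 7; 8; 0] (Embed
  [:: 0; 2; 7] 1 [:: 6; 4; 7; 5; 10; 1; 0; 8] (Embed [:: 0; 7] 1 [:: 6; 4; 7; 5; 10; 1; 0; 8]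
  (Embed [:: 0; 2; 5] 4 [:: 4; 1; 7; 5; 10; 6; 0; 3] (Embed [:: 0; 2] 1
  [:: 6; 4; 7; 5; 10; 1; 0; 3] (Split [:: 2; 9] (Recolor [:: 1]) (Split [:: 2] (Recolor [:: 1])
  (Recolor [:: 2]))))))))) (Split [:: 2; 4] (Embed [:: 0; 2; 9] 0
  [:: 0; 2; 4; 3; 9; 6; 7; 8; 5; 10] (Embed [:: 0; 2] 3 [:: 9; 10; 4; 3; 0; 1; 6; 7] (Recolor
  [:: 2]))) (Split [:: 2] (Embed [:: 0; 2; 7; 9] 3 [:: 9; 6; 10; 1; 4; 7; 3; 0] (Embed
  [:: 0; 2; 9] 1 [:: 0; 2; 4; 3; 9; 6; 7; 8; 5; 10] (Embed [:: 2; 9] 1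
  [:: 0; 2; 4; 3; 9; 6; 7; 8; 5; 10] (Embed [:: 0; 2; 5] 0 [:: 0; 2; 4; 3; 9; 6; 7; 8; 5; 10]
  (Embed [:: 0; 2] 7 [:: 1; 0; 4; 9; 5; 3; 7; 6; 10] (Split [:: 2] (Recolor [:: 1]) (Recolor
  [:: 2]))))))) (Recolor [:: 2])))))))) (Split [:: 3; 5] (Embed [:: 0; 1; 2; 8] 4
  [:: 5; 6; 9; 1; 7; 8; 3; 0] (Embed [:: 0; 2; 8] 4 [:: 5; 6; 9; 1; 7; 8; 3; 0] (Embed
  [:: 0; 1; 8] 4 [:: 5; 6; 9; 1; 7; 4; 2; 0] (Embed [:: 0; 2] 3 [:: 9; 4; 5; 3; 0; 1; 7; 6] (Embed
  [:: 0; 1] 3 [:: 9; 8; 5; 2; 0; 1; 7; 6] (Split [:: 2; 8] (Embed [:: 0; 2; 5; 7] 4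
  [:: 10; 9; 6; 1; 4; 7; 8; 0] (Embed [:: 0; 5; 7] 4 [:: 10; 9; 6; 1; 4; 7; 8; 0] (Embed
  [:: 0; 2; 7] 2 [:: 6; 4; 7; 5; 10; 1; 0; 8] (Embed [:: 0; 7] 2 [:: 6; 4; 7; 5; 10; 1; 0; 8]
  (Embed [:: 0; 2; 5] 5 [:: 4; 1; 7; 5; 10; 6; 0; 3] (Split [:: 2; 9] (Recolor [:: 1]) (Split
  [:: 2] (Recolor [:: 1]) (Recolor [:: 2])))))))) (Split [:: 2; 4] (Embed [:: 0; 2; 7; 9] 5
  [:: 6; 7; 10; 1; 4; 9; 8; 0] (Embed [:: 0; 2; 9] 0 [:: 0; 2; 4; 3; 9; 6; 7; 8; 5; 10] (Embed
  [:: 0; 2; 7] 3 [:: 10; 4; 9; 2; 6; 1; 0; 8] (Embed [:: 0; 2] 4 [:: 9; 10; 4; 3; 0; 1; 6; 7]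
  (Split [:: 2; 5] (Split [:: 1; 9] (Recolor [:: 8]) (Split [:: 1; 5] (Recolor [:: 5]) (Recolor
  [:: 1]))) (Recolor [:: 2])))))) (Split [:: 2] (Embed [:: 0; 2; 7; 9] 4
  [:: 9; 6; 10; 1; 4; 7; 3; 0] (Embed [:: 0; 1; 6; 9] 0 [:: 1; 2; 3; 4; 5; 0; 7; 8; 9; 10] (Embed
  [:: 2; 9] 1 [:: 0; 2; 4; 3; 9; 6; 7; 8; 5; 10] (Embed [:: 0; 2; 5; 7] 5
  [:: 10; 5; 6; 1; 4; 7; 8; 0] (Embed [:: 0; 2; 5] 0 [:: 0; 2; 4; 3; 9; 6; 7; 8; 5; 10] (Split
  [:: 2] (Split [:: 0; 1; 2; 10] (Recolor [:: 3]) (Recolor [:: 1])) (Recolor [:: 2])))))))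
  (Recolor [:: 2]))))))))) (Split [:: 5] (Embed [:: 0; 5; 8] 0 [:: 1; 2; 3; 4; 0; 6; 7; 8; 9]
  (Embed [:: 0; 1; 2; 8] 3 [:: 4; 5; 9; 1; 7; 6; 3; 0] (Embed [:: 0; 2; 8] 3
  [:: 4; 5; 9; 1; 7; 6; 3; 0] (Embed [:: 0; 1; 8] 3 [:: 8; 5; 9; 1; 7; 6; 2; 0] (Embed
  [:: 0; 2; 4] 6 [:: 9; 8; 5; 1; 7; 6; 3; 0] (Embed [:: 0; 1; 4] 6 [:: 9; 4; 5; 1; 7; 6; 2; 0]
  (Embed [:: 0; 2] 4 [:: 5; 9; 6; 1; 0; 3; 8; 7] (Embed [:: 0; 1] 4 [:: 9; 5; 4; 1; 0; 2; 6; 7]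
  (Split [:: 2; 8] (Embed [:: 0; 2; 5; 7] 5 [:: 10; 9; 6; 1; 4; 7; 8; 0] (Embed [:: 0; 2; 7] 3
  [:: 6; 4; 7; 5; 10; 1; 0; 8] (Embed [:: 0; 7] 3 [:: 6; 4; 7; 5; 10; 1; 0; 8] (Embed [:: 0; 2; 5]
  6 [:: 4; 1; 7; 5; 10; 6; 0; 3] (Embed [:: 0; 2] 3 [:: 6; 4; 7; 5; 10; 1; 0; 3] (Split [:: 2; 9]
  (Recolor [:: 1]) (Split [:: 2] (Recolor [:: 1]) (Recolor [:: 2])))))))) (Split [:: 2; 4] (Embed
  [:: 0; 2; 9] 0 [:: 0; 2; 4; 3; 9; 6; 7; 8; 5; 10] (Recolor [:: 2])) (Split [:: 2] (Embed
  [:: 0; 2; 7; 9] 5 [:: 9; 6; 10; 1; 4; 7; 3; 0] (Embed [:: 0; 2; 9] 1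
  [:: 0; 2; 4; 3; 9; 6; 7; 8; 5; 10] (Embed [:: 2; 9] 1 [:: 0; 2; 4; 3; 9; 6; 7; 8; 5; 10] (Embed
  [:: 0; 2; 5; 7] 6 [:: 10; 5; 6; 1; 4; 7; 8; 0] (Embed [:: 0; 2] 9
  [:: 1; 0; 4; 9; 5; 3; 7; 6; 10] (Split [:: 2] (Split [:: 0; 1; 2; 10] (Recolor [:: 3]) (Recolor
  [:: 1])) (Recolor [:: 2]))))))) (Recolor [:: 2])))))))))))) (Recolor [:: 5])))))) (Split
  [:: 1; 2] (Embed [:: 0; 1; 7] 0 [:: 0; 3; 2; 4; 8; 7; 6; 5] (Embed [:: 1; 7] 0
  [:: 0; 3; 2; 4; 8; 7; 6; 5] (Embed [:: 0; 4; 6] 4 [:: 4; 8; 5; 1; 3; 6; 7; 0] (Embed [:: 3; 6] 0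
  [:: 1; 0; 3; 5; 4; 8; 7; 6] (Embed [:: 0; 6] 5 [:: 5; 4; 6; 0; 1; 3; 8; 7] (Embed [:: 0; 1; 5] 0
  [:: 0; 7; 1; 5; 6; 3; 8; 4] (Embed [:: 0; 5] 0 [:: 0; 7; 1; 5; 6; 3; 8; 4] (Split [:: 1; 3]
  (Embed [:: 0; 1; 6; 8] 4 [:: 5; 6; 9; 1; 3; 8; 7; 0] (Embed [:: 0; 6; 8] 0
  [:: 1; 2; 0; 6; 5; 9; 4; 7] (Embed [:: 0; 3; 7] 0 [:: 0; 7; 1; 9; 8; 3; 6; 5] (Embed [:: 0; 7] 0
  [:: 0; 7; 1; 9; 8; 3; 6; 5] (Embed [:: 4; 6] 0 [:: 1; 0; 3; 9; 5; 6; 7; 8] (Embed [:: 0; 6] 5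
  [:: 9; 5; 8; 0; 1; 3; 6; 7] (Split [:: 1; 5] (Embed [:: 0; 3; 7; 9] 0
  [:: 3; 2; 1; 10; 6; 7; 4; 0] (Embed [:: 0; 7; 9] 0 [:: 1; 4; 0; 6; 7; 8; 9; 10] (Embed
  [:: 0; 1; 9] 3 [:: 4; 9; 2; 1; 3; 6; 10; 0] (Embed [:: 0; 4; 8] 0 [:: 0; 10; 1; 8; 5; 3; 6; 7]
  (Embed [:: 0; 1; 4] 0 [:: 0; 10; 1; 8; 5; 3; 6; 7] (Embed [:: 0; 1] 3
  [:: 9; 10; 4; 1; 0; 2; 6; 7] (Split [:: 1; 4] (Recolor [:: 8]) (Split [:: 1; 2; 9] (Embed
  [:: 0; 5; 7; 9] 1 [:: 5; 2; 3; 0; 8; 7; 4; 1] (Embed [:: 0; 7; 9] 1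
  [:: 1; 6; 0; 7; 11; 10; 9; 8] (Embed [:: 0; 4; 8] 1 [:: 0; 8; 1; 10; 5; 3; 7; 11] (Embed
  [:: 0; 7] 1 [:: 5; 2; 3; 0; 8; 7; 4; 1] (Embed [:: 0; 4] 1 [:: 0; 8; 1; 10; 5; 3; 7; 11] (Split
  [:: 1; 4; 8] (Embed [:: 0; 1; 6; 7; 10] 1 [:: 5; 4; 3; 0; 8; 9; 6; 1] (Embed [:: 0; 1; 6; 10] 10
  [:: 0; 1; 2; 3; 4; 5; 6; 7; 8; 9; 10; 11; 12] (Embed [:: 0; 1; 10] 9
  [:: 3; 1; 5; 0; 7; 2; 10; 4; 12; 11; 6; 9; 8] (Embed [:: 0; 1; 6; 7] 1
  [:: 1; 11; 0; 9; 10; 7; 12; 8] (Embed [:: 0; 1; 7] 1 [:: 5; 4; 3; 0; 8; 9; 6; 1] (Embed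
  [:: 0; 1; 6] 9 [:: 4; 2; 6; 0; 11; 1; 12; 3; 10; 7; 5; 8; 9] (Embed [:: 0; 1] 12
  [:: 0; 1; 2; 3; 4; 5; 6; 7; 8; 9; 10; 11; 12] (Split [:: 1] (Recolor [:: 1]) (Recolor
  [:: 1]))))))))) (Recolor [:: 1]))))))) (Recolor [:: 1]))))))))) (Split [:: 1; 2] (Embed
  [:: 0; 7; 9] 3 [:: 4; 3; 1; 8; 7; 6; 10; 0] (Embed [:: 0; 1; 6; 9] 4
  [:: 8; 9; 7; 1; 3; 6; 10; 0] (Embed [:: 0; 6; 9] 1 [:: 1; 2; 0; 9; 4; 7; 6; 10] (Embed
  [:: 0; 1; 9] 0 [:: 3; 0; 5; 2; 8; 10; 6; 7; 4; 9] (Embed [:: 0; 9] 3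
  [:: 7; 3; 6; 9; 4; 1; 0; 10] (Embed [:: 0; 7] 3 [:: 6; 4; 7; 5; 3; 1; 0; 8] (Split [:: 0; 5]
  (Embed [:: 0; 2; 7; 9] 6 [:: 2; 1; 5; 11; 7; 8; 0; 10] (Embed [:: 0; 7; 9] 1
  [:: 1; 3; 0; 11; 7; 8; 5; 10] (Embed [:: 0; 2; 5] 4 [:: 2; 5; 1; 6; 11; 7; 3; 0] (Embed
  [:: 0; 5] 4 [:: 5; 8; 2; 6; 0; 1; 7; 4] (Split [:: 5; 6] (Recolor [:: 10]) (Recolor [:: 5]))))))
  (Split [:: 0; 1] (Recolor [:: 9]) (Split [:: 0; 1; 6] (Embed [:: 0; 9] 6
  [:: 4; 7; 2; 10; 0; 1; 8; 5] (Embed [:: 0; 5; 6] 8 [:: 2; 1; 4; 9; 8; 7; 0; 6] (Split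
  [:: 2; 7; 9] (Recolor [:: 6]) (Recolor [:: 9])))) (Recolor [:: 0])))))))))) (Split [:: 0; 1]
  (Embed [:: 0; 3; 7; 9] 2 [:: 1; 8; 2; 10; 0; 4; 7; 6] (Embed [:: 0; 7; 9] 7
  [:: 7; 6; 8; 1; 3; 5; 10; 0] (Embed [:: 0; 6; 9] 5 [:: 8; 9; 7; 1; 3; 6; 10; 0] (Embed [:: 0; 9]
  5 [:: 8; 7; 5; 1; 0; 10; 6; 3] (Embed [:: 0; 4; 6; 8] 2 [:: 1; 9; 3; 7; 0; 5; 10; 6] (Embed
  [:: 0; 6; 8] 7 [:: 10; 6; 9; 1; 2; 4; 7; 0] (Embed [:: 0; 6] 5 [:: 9; 10; 4; 1; 0; 7; 6; 2]
  (Split [:: 0; 4] (Embed [:: 0; 2; 7; 9] 7 [:: 7; 11; 8; 1; 6; 9; 10; 0] (Embed [:: 0; 9] 5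
  [:: 8; 7; 9; 1; 0; 10; 11; 6] (Embed [:: 0; 4; 6; 8] 2 [:: 1; 5; 6; 7; 0; 9; 10; 11] (Embed
  [:: 0; 4; 6] 0 [:: 1; 4; 0; 6; 5; 7; 11; 10; 9; 8] (Embed [:: 0; 6] 2
  [:: 3; 11; 2; 0; 7; 4; 6; 1] (Split [:: 0; 4; 8] (Embed [:: 0; 3; 4] 21
  [:: 9; 8; 12; 11; 6; 10; 4; 7; 1; 0; 5; 3; 2] (Recolor [:: 4])) (Recolor [:: 0]))))))) (Split
  [:: 0; 4; 8] (Embed [:: 4; 8; 10] 0 [:: 1; 2; 3; 4; 5; 6; 7; 8; 9; 0; 11] (Embed
  [:: 0; 2; 7; 10] 3 [:: 2; 7; 1; 5; 3; 0; 11; 10] (Embed [:: 1; 4; 6; 8] 3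
  [:: 1; 11; 2; 9; 6; 4; 7; 0] (Embed [:: 0; 4; 6; 8] 3 [:: 2; 10; 4; 0; 1; 6; 11; 7] (Embed
  [:: 0; 4; 6] 3 [:: 2; 10; 4; 0; 1; 6; 11; 7] (Split [:: 2; 3] (Embed [:: 0; 1; 5; 9] 18
  [:: 2; 3; 0; 1; 5; 4; 7; 6; 8; 12; 11; 10; 9] (Embed [:: 0; 1; 5] 0
  [:: 0; 1; 5; 4; 7; 6; 8; 12; 11; 10; 9] (Split [:: 1; 5; 9] (Embed [:: 0; 4; 5; 9; 12] 3
  [:: 5; 13; 4; 1; 0; 6; 8; 3] (Embed [:: 0; 4; 5; 12] 3 [:: 1; 10; 0; 12; 7; 5; 9; 13] (Embed
  [:: 0; 4; 5; 9] 2 [:: 4; 13; 3; 9; 1; 8; 6; 0; 10; 11] (Embed [:: 0; 4; 5] 18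
  [:: 3; 4; 1; 0; 6; 5; 8; 7; 9; 13; 12; 11; 10] (Recolor [:: 0]))))) (Recolor [:: 1])))) (Split
  [:: 2; 3; 7] (Embed [:: 0; 1; 5; 9; 11] 4 [:: 3; 8; 2; 1; 5; 7; 12; 0] (Embed [:: 0; 6; 10] 4
  [:: 0; 12; 1; 10; 7; 5; 8; 9] (Embed [:: 0; 1; 5; 9] 3 [:: 3; 12; 2; 8; 0; 7; 5; 1; 9; 10]
  (Embed [:: 0; 1; 9] 3 [:: 3; 12; 2; 8; 0; 7; 5; 1; 9; 10] (Embed [:: 0; 1; 5] 0
  [:: 10; 8; 12; 11; 7; 6; 5; 2; 0; 1; 4; 3] (Embed [:: 0; 1] 20
  [:: 0; 1; 2; 3; 4; 5; 6; 7; 8; 9; 10; 11; 12] (Recolor [:: 0]))))))) (Split [:: 3] (Embed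
  [:: 0; 1; 5; 9; 11] 5 [:: 3; 8; 2; 1; 5; 7; 12; 0] (Embed [:: 0; 3; 8; 11] 5
  [:: 3; 7; 4; 1; 5; 8; 12; 0] (Embed [:: 0; 2; 5; 7] 1 [:: 1; 2; 3; 0; 5; 6; 7; 8; 9; 10; 11; 12]
  (Recolor [:: 0])))) (Recolor [:: 3]))))))))) (Embed [:: 0; 3] 1
  [:: 0; 1; 3; 2; 5; 4; 6; 10; 9; 8; 7] (Embed [:: 0; 3; 7] 0
  [:: 0; 1; 3; 2; 5; 4; 6; 10; 9; 8; 7] (Recolor [:: 0])))))))))))) (Split [:: 0; 1; 5] (Embed
  [:: 0; 3; 7; 9] 7 [:: 7; 6; 8; 1; 3; 5; 10; 0] (Embed [:: 0; 7; 9] 3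
  [:: 1; 4; 0; 6; 7; 8; 9; 10] (Embed [:: 1; 9] 2 [:: 3; 0; 5; 2; 8; 10; 6; 7; 4; 9] (Embed
  [:: 0; 9] 8 [:: 8; 7; 5; 0; 1; 3; 6; 10] (Embed [:: 0; 4; 8] 3 [:: 0; 10; 1; 8; 5; 3; 6; 7]
  (Embed [:: 0; 8] 1 [:: 0; 4; 1; 9; 3; 7; 8; 5; 10; 6] (Embed [:: 0; 7] 2
  [:: 0; 4; 1; 9; 3; 7; 8; 5; 10; 6] (Embed [:: 1; 4] 1 [:: 0; 3; 2; 5; 4; 6; 10; 9; 8; 7] (Embed
  [:: 0; 4] 3 [:: 0; 10; 1; 8; 5; 3; 6; 7] (Embed [:: 0; 3] 0 [:: 0; 1; 4; 3; 9; 7; 6; 10; 5; 8]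
  (Split [:: 1; 2; 9] (Embed [:: 0; 5; 7; 9] 7 [:: 11; 7; 10; 1; 3; 5; 8; 0] (Embed [:: 0; 7; 9] 0
  [:: 6; 11; 4; 10; 2; 1; 0; 8; 5; 3] (Embed [:: 5; 6; 9] 0 [:: 1; 4; 3; 6; 5; 7; 0; 10; 9; 8]
  (Embed [:: 0; 9] 2 [:: 0; 6; 1; 9; 3; 11; 10; 5; 8; 7] (Embed [:: 0; 4; 8] 0
  [:: 2; 3; 4; 5; 6; 1; 0; 9; 10; 11] (Embed [:: 0; 8] 1 [:: 0; 6; 1; 9; 3; 11; 10; 5; 8; 7]
  (Embed [:: 0; 7] 8 [:: 10; 11; 5; 0; 1; 3; 7; 8] (Embed [:: 5; 6] 2
  [:: 0; 1; 6; 3; 9; 11; 7; 8; 5; 10] (Embed [:: 0; 5] 0 [:: 0; 1; 6; 3; 9; 11; 7; 8; 5; 10]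
  (Embed [:: 0; 4] 3 [:: 0; 8; 1; 10; 5; 3; 7; 11] (Split [:: 1; 4; 8] (Embed [:: 0; 4; 11] 0
  [:: 4; 3; 6; 5; 11; 1; 0; 12; 7; 10] (Embed [:: 0; 11] 1 [:: 0; 11; 1; 12; 3; 10; 7; 5; 8; 9]
  (Embed [:: 0; 1; 6; 7; 10] 7 [:: 10; 9; 7; 1; 3; 5; 8; 0] (Embed [:: 0; 1; 6; 10] 13
  [:: 12; 8; 11; 9; 6; 10; 4; 7; 1; 3; 5; 2; 0] (Embed [:: 0; 1; 6; 7] 0
  [:: 11; 10; 6; 7; 4; 1; 0; 8; 5; 3] (Embed [:: 0; 1; 7] 8 [:: 7; 10; 5; 0; 1; 3; 9; 8] (Embed
  [:: 0; 7] 8 [:: 7; 10; 5; 0; 1; 3; 9; 8] (Embed [:: 0; 4] 3 [:: 0; 8; 1; 7; 5; 3; 9; 10] (Embed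
  [:: 0; 1] 15 [:: 0; 1; 2; 3; 4; 5; 6; 7; 8; 9; 10; 11; 12] (Split [:: 1; 6; 10] (Embed
  [:: 6; 10; 12] 0 [:: 1; 8; 3; 11; 5; 13; 0; 7; 10; 9] (Split [:: 0; 1] (Recolor [:: 13])
  (Recolor [:: 1]))) (Split [:: 1] (Recolor [:: 1]) (Recolor [:: 1])))))))))))) (Split [:: 1]
  (Embed [:: 0; 1; 6; 10] 0 [:: 3; 0; 5; 2; 7; 4; 10; 12; 8; 9; 6; 11] (Embed [:: 1; 6; 10] 0
  [:: 3; 0; 5; 2; 7; 4; 10; 12; 8; 9; 6; 11] (Recolor [:: 1]))) (Recolor [:: 1])))))))))))))
  (Split [:: 1] (Embed [:: 0; 5; 7; 9] 9 [:: 11; 7; 10; 1; 3; 5; 8; 0] (Embed [:: 0; 1; 5; 6; 9] 3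
  [:: 4; 1; 6; 3; 9; 0; 7; 8; 5; 10] (Embed [:: 0; 5; 6; 9] 3 [:: 4; 1; 6; 3; 9; 0; 7; 8; 5; 10]
  (Embed [:: 0; 1; 4; 8] 0 [:: 0; 3; 2; 5; 4; 10; 8; 7; 11; 6; 9] (Embed [:: 1; 4; 8] 0
  [:: 0; 3; 2; 5; 4; 10; 8; 7; 11; 6; 9] (Embed [:: 0; 1; 5; 6] 1
  [:: 1; 3; 0; 5; 6; 7; 8; 9; 10; 11] (Split [:: 1] (Embed [:: 0; 1; 6; 10] 22
  [:: 0; 1; 2; 3; 4; 5; 6; 7; 8; 9; 10; 11; 12] (Recolor [:: 1])) (Recolor [:: 1])))))))) (Recolor
  [:: 1]))))))))))))) (Split [:: 1] (Embed [:: 1; 2; 9] 0 [:: 3; 0; 5; 2; 8; 10; 6; 7; 4; 9]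
  (Embed [:: 0; 1; 4] 2 [:: 0; 3; 2; 5; 4; 6; 10; 9; 8; 7] (Embed [:: 1; 4] 2
  [:: 0; 3; 2; 5; 4; 6; 10; 9; 8; 7] (Recolor [:: 1])))) (Recolor [:: 1])))))))))))) (Split
  [:: 0; 1] (Embed [:: 0; 6; 8] 3 [:: 3; 2; 1; 7; 6; 5; 9; 0] (Embed [:: 0; 5; 8] 4
  [:: 7; 8; 6; 1; 2; 5; 9; 0] (Embed [:: 0; 8] 3 [:: 6; 2; 5; 8; 3; 1; 0; 9] (Embed [:: 0; 4; 6] 4
  [:: 9; 4; 5; 1; 3; 6; 7; 0] (Embed [:: 0; 6] 3 [:: 5; 3; 6; 4; 2; 1; 0; 7] (Split [:: 5; 7]
  (Embed [:: 0; 4; 5] 5 [:: 7; 8; 6; 1; 9; 10; 5; 0] (Embed [:: 0; 1; 5] 0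
  [:: 0; 3; 1; 5; 6; 7; 8; 9; 10] (Embed [:: 0; 1] 4 [:: 6; 10; 7; 2; 0; 1; 9; 4] (Split [:: 1; 6]
  (Embed [:: 0; 5; 6] 0 [:: 1; 5; 0; 10; 8; 7; 11; 6; 9] (Recolor [:: 5])) (Recolor [:: 1])))))
  (Split [:: 7] (Embed [:: 0; 4; 5] 0 [:: 0; 2; 4; 3; 9; 7; 6; 10; 5; 8] (Embed [:: 4; 5] 0
  [:: 0; 2; 4; 3; 9; 7; 6; 10; 5; 8] (Recolor [:: 4]))) (Recolor [:: 7])))))))) (Split [:: 1]
  (Embed [:: 0; 1; 6; 8] 7 [:: 5; 6; 9; 1; 3; 8; 7; 0] (Embed [:: 0; 6; 8] 7
  [:: 5; 6; 9; 1; 3; 8; 7; 0] (Embed [:: 0; 1; 5; 8] 1 [:: 1; 2; 3; 4; 0; 6; 7; 8; 9] (Embed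
  [:: 0; 3; 4; 7] 2 [:: 1; 4; 3; 5; 0; 8; 7; 6] (Embed [:: 0; 4; 6] 5 [:: 9; 4; 5; 1; 3; 6; 7; 0]
  (Embed [:: 0; 6] 5 [:: 5; 9; 6; 1; 0; 7; 8; 3] (Embed [:: 0; 1; 5] 1
  [:: 0; 3; 2; 8; 6; 5; 9; 4; 7] (Embed [:: 1; 5] 1 [:: 0; 3; 2; 8; 6; 5; 9; 4; 7] (Embed
  [:: 0; 3; 4] 0 [:: 1; 0; 3; 4; 5; 6; 7; 8; 9] (Split [:: 0; 1] (Embed [:: 0; 3; 7; 9] 7
  [:: 7; 6; 8; 1; 3; 5; 10; 0] (Embed [:: 0; 7; 9] 7 [:: 7; 6; 8; 1; 3; 5; 10; 0] (Embed
  [:: 0; 6; 9] 5 [:: 8; 9; 7; 1; 3; 6; 10; 0] (Embed [:: 0; 9] 5 [:: 8; 7; 5; 1; 0; 10; 6; 3]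
  (Embed [:: 0; 4; 6; 8] 2 [:: 1; 9; 3; 7; 0; 5; 10; 6] (Embed [:: 0; 6; 8] 0
  [:: 1; 3; 0; 5; 6; 7; 8; 9; 10] (Embed [:: 0; 6] 8 [:: 9; 10; 4; 2; 3; 6; 7; 0; 1] (Embed
  [:: 1; 5] 8 [:: 5; 8; 3; 1; 4; 7; 6; 0; 2] (Split [:: 1; 8] (Embed [:: 0; 3; 7; 10] 2
  [:: 4; 1; 6; 8; 0; 11; 10; 9] (Embed [:: 0; 7; 10] 9 [:: 2; 4; 5; 3; 1; 11; 6; 9; 8; 0] (Embed
  [:: 0; 1; 5; 6] 7 [:: 8; 9; 7; 1; 10; 11; 6; 0] (Embed [:: 0; 1; 5] 5
  [:: 8; 7; 9; 1; 0; 6; 11; 10] (Recolor [:: 0]))))) (Split [:: 1; 4; 8] (Embed [:: 0; 3; 7; 10] 2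
  [:: 7; 5; 4; 10; 8; 0; 1; 6; 9] (Embed [:: 0; 7; 10] 3 [:: 3; 6; 5; 0; 1; 10; 9; 8] (Split
  [:: 0; 3] (Embed [:: 0; 5] 20 [:: 3; 4; 2; 0; 1; 6; 5; 11; 9; 8; 12; 7; 10] (Recolor [:: 5]))
  (Recolor [:: 0])))) (Split [:: 1; 2] (Embed [:: 0; 5; 7; 9] 4 [:: 1; 10; 4; 8; 0; 6; 11; 7]
  (Split [:: 1; 4] (Embed [:: 0; 1; 6; 7; 10] 2 [:: 9; 6; 8; 4; 1; 0; 2; 5; 3] (Split [:: 1; 5]
  (Split [:: 4; 5] (Split [:: 2; 6] (Split [:: 5; 8] (Split [:: 3; 8] (Recolor [:: 2]) (Recolor
  [:: 3])) (Recolor [:: 5])) (Recolor [:: 2])) (Recolor [:: 4])) (Recolor [:: 1]))) (Recolor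
  [:: 1]))) (Split [:: 1; 2; 9] (Embed [:: 0; 5; 7; 9] 10 [:: 3; 1; 5; 7; 11; 10; 0; 8] (Split
  [:: 1; 4; 8] (Embed [:: 0; 1] 18 [:: 0; 1; 2; 3; 4; 5; 6; 7; 8; 9; 10; 11; 12] (Recolor [:: 1]))
  (Recolor [:: 1]))) (Embed [:: 0; 4] 3 [:: 0; 2; 1; 4; 3; 9; 7; 6; 10; 5; 8] (Embed [:: 0; 4; 8]
  2 [:: 0; 2; 1; 4; 3; 9; 7; 6; 10; 5; 8] (Embed [:: 0; 3] 1 [:: 0; 2; 1; 4; 3; 9; 7; 6; 10; 5; 8]
  (Embed [:: 0; 3; 7] 0 [:: 0; 2; 1; 4; 3; 9; 7; 6; 10; 5; 8] (Recolor [:: 0; 1])))))))))))))))))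
  (Split [:: 1] (Embed [:: 0; 3; 7; 9] 8 [:: 7; 6; 8; 1; 3; 5; 10; 0] (Embed [:: 0; 3; 5; 7] 2
  [:: 1; 4; 3; 9; 0; 6; 10; 5; 8] (Embed [:: 0; 3] 0 [:: 1; 0; 3; 4; 5; 6; 7; 8; 9; 10] (Split
  [:: 1; 2; 9] (Embed [:: 0; 1; 4; 8] 2 [:: 3; 4; 5; 6; 1; 0; 9; 10; 11] (Recolor [:: 1]))
  (Recolor [:: 1]))))) (Recolor [:: 1])))))))))))) (Recolor [:: 1]))))))))))) (Split [:: 1] (Embed
  [:: 0; 4; 7] 0 [:: 1; 2; 3; 0; 5; 6; 7; 8] (Embed [:: 0; 1; 7] 1 [:: 0; 3; 2; 4; 8; 7; 6; 5]
  (Embed [:: 1; 7] 1 [:: 0; 3; 2; 4; 8; 7; 6; 5] (Embed [:: 0; 4; 6] 6 [:: 4; 8; 5; 1; 3; 6; 7; 0]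
  (Embed [:: 0; 3; 6] 4 [:: 5; 2; 4; 1; 3; 8; 7; 0] (Embed [:: 0; 6] 4 [:: 5; 4; 6; 1; 0; 7; 8; 3]
  (Embed [:: 0; 1; 3; 5] 1 [:: 1; 2; 3; 4; 0; 6; 7; 8] (Embed [:: 1; 3] 0
  [:: 3; 0; 6; 8; 4; 5; 2; 7] (Split [:: 0; 1] (Embed [:: 0; 6; 8] 4 [:: 6; 5; 7; 1; 2; 4; 9; 0]
  (Embed [:: 0; 5; 8] 0 [:: 4; 1; 7; 9; 0; 6; 3; 8] (Embed [:: 0; 4; 6] 4
  [:: 9; 4; 5; 1; 3; 6; 7; 0] (Embed [:: 0; 6] 4 [:: 5; 9; 6; 1; 0; 7; 8; 3] (Split [:: 1; 5]
  (Split [:: 4] (Embed [:: 0; 7; 9] 6 [:: 7; 11; 8; 1; 6; 9; 10; 0] (Embed [:: 0; 2; 7] 3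
  [:: 9; 2; 8; 1; 6; 4; 3; 0] (Embed [:: 0; 1; 2] 4 [:: 8; 5; 2; 1; 6; 4; 3; 0] (Split [:: 2; 7]
  (Embed [:: 0; 2; 10] 4 [:: 4; 5; 1; 11; 10; 9; 3; 0] (Recolor [:: 10])) (Recolor [:: 2])))))
  (Recolor [:: 4])) (Split [:: 1; 4] (Recolor [:: 3]) (Split [:: 1; 8] (Embed [:: 1; 9] 1
  [:: 0; 3; 2; 5; 4; 6; 10; 9; 8; 7] (Embed [:: 0; 1; 6; 8] 3 [:: 1; 5; 0; 6; 10; 9; 8; 7] (Embed
  [:: 0; 6; 8] 3 [:: 1; 5; 0; 6; 10; 9; 8; 7] (Split [:: 1; 6] (Split [:: 0; 1; 5] (Embed
  [:: 1; 2; 5] 2 [:: 7; 6; 1; 5; 4; 2; 0; 3] (Embed [:: 0; 5] 1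
  [:: 2; 0; 1; 6; 7; 8; 9; 10; 11; 12] (Recolor [:: 5]))) (Split [:: 5] (Embed [:: 0; 3; 8; 10] 9
  [:: 8; 12; 9; 1; 7; 10; 11; 0] (Embed [:: 0; 2; 3; 8] 6 [:: 10; 8; 9; 1; 7; 12; 3; 0] (Recolor
  [:: 0]))) (Recolor [:: 5]))) (Split [:: 0; 1] (Embed [:: 0; 5] 11
  [:: 5; 3; 9; 8; 7; 2; 1; 0; 6; 11] (Recolor [:: 5])) (Recolor [:: 1])))))) (Split [:: 1] (Embed
  [:: 0; 3; 7; 9] 7 [:: 7; 6; 8; 1; 3; 5; 10; 0] (Embed [:: 0; 7; 9] 7
  [:: 7; 6; 8; 1; 3; 5; 10; 0] (Embed [:: 0; 6; 9] 1 [:: 1; 2; 3; 4; 5; 0; 7; 8; 9; 10] (Embed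
  [:: 0; 1; 9] 2 [:: 0; 3; 2; 5; 4; 6; 10; 9; 8; 7] (Embed [:: 0; 4; 5; 8] 0
  [:: 1; 2; 3; 4; 5; 6; 7; 8; 9; 0] (Embed [:: 0; 3; 5; 7] 2 [:: 1; 2; 3; 4; 5; 6; 0; 8; 9; 10]
  (Embed [:: 0; 1; 6] 0 [:: 0; 3; 2; 5; 4; 6; 10; 9; 8; 7] (Split [:: 0; 3] (Split [:: 2] (Embed
  [:: 0; 1; 6] 6 [:: 6; 3; 2; 1; 4; 5; 7; 0] (Recolor [:: 0])) (Recolor [:: 2])) (Recolor
  [:: 0]))))))))) (Recolor [:: 1]))))))))) (Split [:: 1] (Embed [:: 0; 1; 6; 8] 7
  [:: 5; 6; 9; 1; 3; 8; 7; 0] (Embed [:: 0; 6; 8] 7 [:: 5; 6; 9; 1; 3; 8; 7; 0] (Embed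
  [:: 0; 5; 8] 1 [:: 4; 1; 7; 9; 0; 6; 3; 8] (Embed [:: 0; 3; 4; 7] 2 [:: 1; 4; 3; 5; 0; 8; 7; 6]
  (Embed [:: 0; 1; 4; 6] 5 [:: 9; 4; 5; 1; 3; 6; 7; 0] (Embed [:: 0; 4; 6] 5
  [:: 9; 4; 5; 1; 3; 6; 7; 0] (Embed [:: 0; 1; 6] 5 [:: 5; 9; 6; 1; 0; 7; 8; 3] (Embed
  [:: 0; 1; 4] 8 [:: 3; 1; 6; 7; 2; 0; 5; 9; 4] (Embed [:: 0; 3] 0 [:: 1; 0; 3; 4; 5; 6; 7; 8; 9]
  (Split [:: 0; 1] (Embed [:: 0; 3; 7; 9] 5 [:: 7; 6; 8; 1; 3; 5; 10; 0] (Embed [:: 0; 7; 9] 0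
  [:: 2; 1; 4; 0; 6; 7; 8; 9; 10] (Embed [:: 0; 6; 9] 8 [:: 2; 4; 1; 3; 8; 7; 0; 10; 5] (Embed
  [:: 0; 9] 9 [:: 4; 2; 6; 7; 8; 3; 1; 0; 10; 5] (Embed [:: 0; 4; 6; 8] 5
  [:: 6; 10; 7; 1; 2; 4; 9; 0] (Embed [:: 0; 6; 8] 0 [:: 1; 3; 0; 5; 6; 7; 8; 9; 10] (Embed
  [:: 1; 5; 8] 9 [:: 3; 1; 10; 5; 8; 4; 2; 0; 6; 7] (Embed [:: 2; 5; 7] 9
  [:: 2; 1; 7; 4; 9; 5; 3; 0; 6; 10] (Embed [:: 0; 6] 9 [:: 5; 3; 6; 10; 9; 2; 1; 0; 7; 4] (Split
  [:: 1; 2] (Recolor [:: 1]) (Split [:: 1; 2; 9] (Embed [:: 0; 5; 7; 9] 8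
  [:: 3; 1; 5; 7; 11; 10; 0; 8] (Split [:: 1; 4; 8] (Recolor [:: 1]) (Recolor [:: 1]))) (Embed
  [:: 1; 2; 6] 0 [:: 0; 1; 3; 2; 5; 4; 6; 10; 9; 8; 7] (Split [:: 0; 4] (Recolor [:: 3]) (Split
  [:: 0; 4; 8] (Recolor [:: 3]) (Embed [:: 0; 3] 1 [:: 0; 1; 3; 2; 5; 4; 6; 10; 9; 8; 7] (Embed
  [:: 0; 3; 7] 0 [:: 0; 1; 3; 2; 5; 4; 6; 10; 9; 8; 7] (Recolor [:: 0; 1; 2])))))))))))))))))
  (Split [:: 0; 1; 8] (Embed [:: 0; 4; 6; 8] 8 [:: 2; 1; 4; 6; 10; 9; 0; 7] (Embed [:: 0; 6; 8] 3
  [:: 1; 5; 0; 6; 10; 9; 8; 7] (Embed [:: 4; 5; 8] 0 [:: 1; 3; 2; 5; 4; 6; 0; 9; 8; 7] (Embed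
  [:: 2; 5; 7] 2 [:: 1; 7; 3; 10; 6; 0; 8; 5] (Embed [:: 0; 6] 5 [:: 9; 2; 4; 6; 10; 1; 0; 7]
  (Split [:: 2; 6] (Embed [:: 0; 4; 8; 10] 2 [:: 2; 8; 11; 4; 1; 0; 9; 6] (Embed [:: 0; 8; 10] 2
  [:: 2; 8; 11; 4; 1; 0; 9; 6] (Recolor [:: 0]))) (Split [:: 2; 3; 7] (Embed [:: 0; 7; 10] 3
  [:: 4; 7; 1; 6; 11; 0; 8; 9] (Embed [:: 0; 10] 0 [:: 7; 5; 3; 8; 2; 9; 0; 11; 6; 4; 1] (Split
  [:: 1; 5] (Embed [:: 0; 1; 3; 8; 10] 3 [:: 10; 4; 7; 11; 0; 1; 3; 12] (Embed [:: 0; 8; 10] 3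
  [:: 9; 3; 10; 0; 1; 7; 12; 11] (Embed [:: 0; 5; 7; 9] 3 [:: 3; 9; 1; 12; 8; 0; 10; 7] (Embed
  [:: 0; 1; 3; 8] 3 [:: 3; 9; 5; 1; 0; 2; 10; 7] (Embed [:: 0; 8] 0
  [:: 0; 3; 4; 1; 6; 7; 8; 9; 10; 11; 12] (Split [:: 0; 5; 9] (Recolor [:: 2]) (Recolor
  [:: 0]))))))) (Recolor [:: 5])))) (Split [:: 1; 2; 6] (Embed [:: 0; 4; 8; 10] 4
  [:: 9; 3; 6; 0; 1; 4; 2; 11] (Embed [:: 0; 8; 10] 4 [:: 9; 3; 6; 0; 1; 4; 2; 11] (Embed
  [:: 0; 10] 7 [:: 9; 4; 6; 7; 8; 1; 0; 11] (Embed [:: 4; 6; 8] 2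
  [:: 1; 3; 4; 5; 6; 7; 0; 9; 10; 11] (Split [:: 1; 8] (Recolor [:: 7]) (Split [:: 1; 5] (Embed
  [:: 0; 3; 8; 10] 5 [:: 10; 4; 7; 11; 0; 1; 3; 12] (Embed [:: 0; 8; 10] 5
  [:: 9; 3; 10; 0; 1; 7; 12; 11] (Embed [:: 1; 10] 0 [:: 8; 5; 12; 3; 7; 4; 10; 0; 2; 9; 6; 11]
  (Embed [:: 0; 1; 5; 7; 9] 5 [:: 3; 9; 1; 12; 8; 0; 10; 7] (Embed [:: 0; 1; 5; 9] 1
  [:: 0; 3; 4; 1; 6; 7; 8; 9; 10; 11; 12] (Embed [:: 0; 1; 5] 4 [:: 0; 1; 6; 7; 8; 9; 10; 11; 12]
  (Split [:: 1; 5; 9] (Split [:: 0; 1; 4; 9] (Recolor [:: 3]) (Recolor [:: 1])) (Recolor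
  [:: 1])))))))) (Split [:: 1; 5; 9] (Embed [:: 0; 1; 5; 7; 9] 6 [:: 3; 9; 1; 12; 8; 0; 10; 11]
  (Embed [:: 0; 1; 5; 9] 6 [:: 3; 9; 1; 5; 2; 0; 10; 7] (Embed [:: 0; 1; 5] 0
  [:: 0; 3; 2; 5; 4; 7; 6; 8; 12; 11; 10; 9] (Split [:: 0; 8] (Recolor [:: 8]) (Recolor
  [:: 0]))))) (Split [:: 1] (Embed [:: 1; 5; 9] 0 [:: 0; 3; 2; 5; 4; 7; 6; 8; 12; 11; 10; 9]
  (Recolor [:: 1])) (Recolor [:: 1]))))))))) (Recolor [:: 2]))))))))) (Embed [:: 0; 1; 5] 0
  [:: 0; 2; 1; 4; 3; 5; 9; 8; 7; 6] (Split [:: 1; 5] (Recolor [:: 1]) (Split [:: 1; 8] (Recolor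
  [:: 1]) (Recolor [:: 1]))))))))))))))) (Recolor [:: 1]))))))))))) (Recolor [:: 1])))))) (Embed
  [:: 1; 4] 0 [:: 0; 1; 3; 2; 6; 5; 4] (Split [:: 4] (Embed [:: 0; 3; 6] 0
  [:: 3; 1; 5; 4; 0; 7; 6] (Embed [:: 0; 2; 4] 0 [:: 1; 2; 3; 0; 5; 6; 7] (Embed [:: 0; 1; 3] 0
  [:: 0; 6; 3; 4; 5; 2; 7] (Embed [:: 1; 3] 0 [:: 0; 6; 3; 4; 5; 2; 7] (Embed [:: 0; 1; 2] 0
  [:: 3; 5; 1; 0; 2; 7; 6] (Embed [:: 1; 2] 0 [:: 0; 6; 4; 3; 7; 2; 5] (Embed [:: 0; 1] 3
  [:: 4; 3; 5; 1; 0; 2; 7; 6] (Split [:: 1] (Embed [:: 0; 4; 7] 0 [:: 1; 7; 5; 0; 8; 3; 6] (Embed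
  [:: 0; 6] 3 [:: 5; 4; 6; 1; 0; 7; 8; 3] (Embed [:: 0; 3; 5] 0 [:: 1; 7; 4; 0; 6; 3; 8] (Split
  [:: 1; 4] (Embed [:: 0; 1; 6; 8] 0 [:: 1; 8; 5; 6; 7; 0; 9] (Embed [:: 0; 6; 8] 0
  [:: 1; 8; 5; 6; 7; 0; 9] (Embed [:: 0; 1; 8] 2 [:: 7; 3; 8; 5; 6; 1; 0; 9] (Embed [:: 0; 8] 2
  [:: 7; 3; 8; 5; 6; 1; 0; 9] (Embed [:: 0; 3; 4; 7] 0 [:: 1; 9; 7; 6; 5; 0; 8] (Embed [:: 2; 4] 2
  [:: 7; 1; 6; 9; 8; 3; 0; 5] (Split [:: 1; 5] (Split [:: 3; 6] (Recolor [:: 2]) (Split [:: 1; 8]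
  (Recolor [:: 4]) (Split [:: 1; 4] (Recolor [:: 4]) (Recolor [:: 1; 3])))) (Split [:: 0; 1]
  (Embed [:: 0; 3; 7; 9] 1 [:: 1; 9; 7; 2; 4; 0; 8] (Embed [:: 0; 7; 9] 4
  [:: 7; 6; 8; 1; 3; 5; 10; 0] (Embed [:: 0; 4; 5; 8] 3 [:: 4; 8; 9; 1; 2; 7; 6; 0] (Embed
  [:: 0; 5; 7] 4 [:: 10; 9; 6; 1; 2; 7; 8; 0] (Embed [:: 2; 3; 6] 4 [:: 9; 8; 4; 3; 1; 2; 7; 0]
  (Split [:: 2; 9] (Embed [:: 0; 2; 6; 8] 1 [:: 8; 1; 10; 9; 0; 7; 11] (Embed [:: 0; 8] 1
  [:: 4; 10; 0; 1; 11; 6; 9] (Embed [:: 0; 1; 4; 7] 3 [:: 7; 9; 8; 1; 11; 10; 5; 0] (Split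
  [:: 0; 2] (Embed [:: 0; 6] 15 [:: 9; 8; 10; 6; 4; 11; 3; 12; 0; 1; 2; 5; 7] (Recolor [:: 6]))
  (Recolor [:: 0]))))) (Split [:: 1; 2] (Embed [:: 0; 8; 10] 5 [:: 8; 7; 9; 1; 4; 6; 11; 0] (Split
  [:: 1; 5] (Split [:: 1; 6] (Split [:: 4; 5] (Split [:: 2; 5] (Split [:: 5; 9] (Split [:: 3; 7]
  (Recolor [:: 2]) (Recolor [:: 3])) (Recolor [:: 5])) (Recolor [:: 2])) (Recolor [:: 5]))
  (Recolor [:: 1])) (Split [:: 1] (Embed [:: 0; 3; 6] 3 [:: 1; 2; 7; 0; 4; 3; 5] (Recolor [:: 0]))
  (Recolor [:: 1])))) (Split [:: 0; 9] (Embed [:: 0; 5; 7; 9] 3 [:: 9; 1; 7; 8; 0; 10; 11] (Split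
  [:: 0; 8] (Embed [:: 0; 6; 7; 10] 3 [:: 10; 8; 2; 1; 0; 11; 12] (Recolor [:: 7])) (Split
  [:: 0; 5] (Embed [:: 0; 3; 4; 9] 4 [:: 12; 0; 3; 2; 1; 7; 5] (Embed [:: 0; 3] 2
  [:: 2; 0; 4; 1; 6; 7; 8; 9; 10; 11; 12] (Recolor [:: 0]))) (Recolor [:: 0])))) (Split [:: 0; 8]
  (Recolor [:: 3]) (Split [:: 0; 4] (Recolor [:: 3]) (Split [:: 0] (Embed [:: 0; 5; 6; 9] 2
  [:: 1; 2; 3; 4; 5; 6; 7; 8; 9; 10; 0] (Split [:: 0; 2; 5] (Recolor [:: 5]) (Recolor [:: 0])))
  (Recolor [:: 0; 2])))))))))))) (Split [:: 0; 1; 6] (Embed [:: 2; 9] 0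
  [:: 0; 10; 3; 6; 1; 4; 9; 8; 7; 2] (Split [:: 2; 3; 9] (Recolor [:: 5]) (Embed [:: 1; 2; 5] 0
  [:: 0; 5; 10; 3; 6; 1; 4; 9; 8; 7; 2] (Recolor [:: 2])))) (Split [:: 0; 1; 4] (Embed
  [:: 0; 4; 6; 8] 3 [:: 3; 9; 6; 1; 0; 5; 10] (Split [:: 2; 3; 7] (Recolor [:: 9]) (Split
  [:: 1; 8] (Recolor [:: 4]) (Split [:: 1; 7] (Embed [:: 0; 3; 4; 10] 1
  [:: 0; 3; 2; 5; 4; 10; 8; 7; 11; 6; 9] (Embed [:: 0; 5; 6; 9] 5 [:: 8; 0; 5; 3; 1; 9; 10]
  (Recolor [:: 0]))) (Split [:: 1; 4] (Recolor [:: 4]) (Split [:: 0; 3; 6] (Embed [:: 0; 5; 6; 9]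
  7 [:: 3; 0; 9; 8; 1; 5; 10] (Split [:: 2] (Recolor [:: 0]) (Recolor [:: 2]))) (Split [:: 1]
  (Embed [:: 0; 5; 7; 9] 2 [:: 1; 2; 3; 4; 5; 6; 7; 8; 0; 10; 11] (Embed [:: 0; 5; 6; 9] 10
  [:: 5; 9; 10; 1; 3; 8; 7; 0] (Recolor [:: 0]))) (Recolor [:: 1; 3])))))))) (Recolor
  [:: 1]))))))))))) (Embed [:: 1; 3] 0 [:: 0; 1; 2; 3; 5; 4; 8; 7; 6] (Split [:: 1; 7] (Embed
  [:: 0; 4; 6] 1 [:: 6; 1; 8; 7; 0; 5; 9] (Embed [:: 0; 1; 6] 1 [:: 2; 8; 1; 0; 7; 4; 9] (Embed
  [:: 0; 6] 1 [:: 3; 4; 0; 1; 9; 8; 7] (Embed [:: 0; 1; 5] 0 [:: 0; 3; 2; 8; 5; 6; 7; 4; 9] (Embed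
  [:: 1; 5] 0 [:: 0; 3; 2; 8; 5; 6; 7; 4; 9] (Embed [:: 0; 1; 4] 0 [:: 0; 3; 2; 8; 6; 5; 9; 4; 7]
  (Split [:: 0; 5] (Recolor [:: 2]) (Split [:: 0] (Recolor [:: 2]) (Recolor [:: 0]))))))))) (Embed
  [:: 1; 5] 0 [:: 0; 1; 2; 3; 5; 4; 8; 7; 6] (Split [:: 1] (Embed [:: 0; 1; 6; 8] 5
  [:: 6; 5; 7; 1; 3; 8; 9; 0] (Embed [:: 0; 6; 8] 5 [:: 6; 5; 7; 1; 3; 8; 9; 0] (Embed
  [:: 0; 5; 8] 1 [:: 1; 2; 3; 4; 6; 0; 9; 8; 7] (Embed [:: 1; 8] 0 [:: 0; 3; 2; 8; 5; 6; 7; 4; 9]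
  (Embed [:: 0; 4; 6] 1 [:: 1; 2; 3; 4; 5; 0; 7; 8; 9] (Embed [:: 1; 6] 0
  [:: 0; 3; 2; 8; 6; 5; 9; 4; 7] (Embed [:: 0; 1; 5] 1 [:: 0; 3; 2; 8; 5; 6; 7; 4; 9] (Embed
  [:: 0; 1; 4] 1 [:: 0; 3; 2; 8; 6; 5; 9; 4; 7] (Split [:: 1] (Recolor [:: 1]) (Recolor
  [:: 1])))))))))) (Recolor [:: 1]))))))))) (Recolor [:: 1]))))))))) (Recolor [:: 4])))) (Embed
  [:: 1; 4] 0 [:: 0; 4; 3; 2; 1; 5] (Embed [:: 1; 3] 0 [:: 0; 5; 1; 2; 3; 4] (Embed [:: 0; 3] 0
  [:: 0; 3; 2; 1; 5; 4] (Embed [:: 0; 2] 0 [:: 0; 4; 5; 1; 2; 3] (Split [:: 4] (Split [:: 0; 3]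
  (Embed [:: 0; 6] 0 [:: 0; 6; 5; 1; 2; 7] (Embed [:: 1; 5] 0 [:: 0; 5; 1; 2; 7; 6] (Embed
  [:: 0; 5] 0 [:: 0; 7; 2; 1; 5; 6] (Embed [:: 1; 4] 0 [:: 0; 6; 7; 2; 1; 5] (Embed [:: 1; 3] 2
  [:: 6; 1; 5; 3; 7; 2; 0; 4] (Embed [:: 0; 2] 2 [:: 6; 2; 7; 4; 5; 1; 0; 3] (Split [:: 3] (Embed
  [:: 0; 1] 6 [:: 1; 0; 5; 4; 3; 2; 6; 7; 8] (Split [:: 0; 2] (Split [:: 1; 8] (Embed [:: 1; 9] 0
  [:: 0; 1; 3; 2; 5; 10] (Embed [:: 0; 1; 7] 0 [:: 1; 7; 8; 0; 2; 3] (Split [:: 0; 3] (Split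
  [:: 2; 9] (Recolor [:: 9]) (Recolor [:: 2])) (Recolor [:: 3])))) (Split [:: 1; 7] (Split [:: 5]
  (Recolor [:: 2]) (Recolor [:: 5])) (Split [:: 1; 6] (Embed [:: 1; 7] 1
  [:: 0; 3; 2; 6; 7; 4; 5; 10; 9; 8] (Recolor [:: 1])) (Split [:: 1] (Split [:: 0; 4] (Split
  [:: 2] (Embed [:: 0; 1; 8] 5 [:: 7; 3; 2; 1; 4; 5; 9; 0] (Recolor [:: 0])) (Recolor [:: 2]))
  (Recolor [:: 0])) (Recolor [:: 1]))))) (Split [:: 2] (Embed [:: 0; 1; 7] 7
  [:: 6; 2; 7; 3; 1; 0; 8; 9; 4] (Embed [:: 0; 5] 0 [:: 1; 0; 3; 4; 5; 6; 7; 8; 9] (Embed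
  [:: 0; 1; 4] 7 [:: 1; 0; 4; 3; 6; 5; 9; 8; 7] (Split [:: 0; 1] (Embed [:: 2; 8] 8
  [:: 2; 1; 10; 5; 4; 7; 3; 0; 9; 8] (Embed [:: 1; 8] 8 [:: 3; 1; 8; 7; 6; 5; 2; 0; 9; 10] (Split
  [:: 1; 2] (Recolor [:: 1]) (Split [:: 0; 6] (Recolor [:: 3]) (Embed [:: 0; 4] 0
  [:: 0; 1; 3; 2; 6; 7; 4; 5; 10; 9; 8] (Recolor [:: 0; 1; 2])))))) (Split [:: 0; 1; 8] (Embed
  [:: 1; 7] 1 [:: 2; 0; 3; 1; 9; 8; 7; 6; 10] (Split [:: 1; 3; 6] (Embed [:: 0; 10] 1
  [:: 10; 9; 0; 11; 4; 8; 1; 3; 2] (Embed [:: 0; 3; 8] 2 [:: 0; 2; 3; 1; 8; 4] (Split [:: 1; 5]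
  (Split [:: 1; 9] (Split [:: 0; 1; 6; 9] (Recolor [:: 3]) (Recolor [:: 1])) (Recolor [:: 1]))
  (Recolor [:: 5])))) (Embed [:: 1; 2; 7] 0 [:: 0; 5; 2; 4; 3; 1; 9; 8; 7; 6; 10] (Recolor
  [:: 1])))) (Split [:: 1; 8] (Embed [:: 2; 9] 3 [:: 0; 6; 7; 3; 1; 10] (Embed [:: 1; 2; 7] 0
  [:: 0; 3; 2; 6; 7; 4; 5; 10; 9; 8] (Embed [:: 0; 7] 2 [:: 4; 5; 0; 8; 6; 10; 1; 3; 7] (Embed
  [:: 0; 1; 3; 6] 3 [:: 0; 6; 10; 1; 3; 7] (Embed [:: 0; 6] 3 [:: 0; 6; 10; 1; 3; 7] (Embed
  [:: 2; 4; 5] 3 [:: 5; 1; 3; 0; 6; 10] (Split [:: 1; 7] (Recolor [:: 1; 3]) (Recolor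
  [:: 1])))))))) (Split [:: 1; 7] (Recolor [:: 1]) (Split [:: 1; 3; 4] (Embed [:: 1; 8] 0
  [:: 0; 3; 2; 6; 7; 4; 5; 10; 9; 8] (Embed [:: 1; 2; 7] 2 [:: 0; 3; 2; 6; 7; 4; 5; 10; 9; 8]
  (Recolor [:: 1]))) (Recolor [:: 1]))))))))) (Split [:: 1] (Embed [:: 0; 4] 1
  [:: 0; 1; 6; 5; 4; 3; 7; 8; 9] (Split [:: 1; 8] (Embed [:: 2; 9] 2 [:: 0; 6; 7; 3; 1; 10] (Embed
  [:: 0; 7] 0 [:: 3; 2; 0; 1; 5; 4; 8; 9; 10] (Embed [:: 0; 6] 2 [:: 0; 6; 10; 1; 3; 7] (Split
  [:: 1; 9] (Recolor [:: 1; 3]) (Recolor [:: 1]))))) (Recolor [:: 1]))) (Recolor [:: 1; 2])))))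
  (Embed [:: 2] 0 [:: 0; 2; 1; 4; 3; 7; 6; 5] (Recolor [:: 2; 3]))))))))) (Embed [:: 0; 2] 0
  [:: 0; 1; 5; 4; 3; 2; 6] (Split [:: 0; 1] (Embed [:: 0; 5] 0 [:: 1; 0; 5; 4; 3; 7; 6] (Embed
  [:: 0; 4] 0 [:: 1; 0; 6; 7; 3; 4; 5] (Split [:: 1; 5] (Embed [:: 0; 1; 4] 0
  [:: 0; 1; 8; 4; 5; 6; 7] (Embed [:: 0; 4] 0 [:: 0; 1; 8; 4; 5; 6; 7] (Embed [:: 0; 3] 0
  [:: 0; 1; 6; 5; 4; 8; 7] (Split [:: 1; 4] (Embed [:: 0; 1; 8] 0 [:: 1; 0; 8; 7; 6; 5; 9] (Embed
  [:: 0; 8] 0 [:: 1; 0; 8; 7; 6; 5; 9] (Embed [:: 0; 3; 7] 0 [:: 1; 0; 9; 5; 6; 7; 8] (Embed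
  [:: 0; 7] 0 [:: 1; 0; 9; 5; 6; 7; 8] (Split [:: 0; 1] (Embed [:: 2; 3; 9] 1
  [:: 0; 2; 1; 3; 5; 4] (Embed [:: 0; 3; 9] 1 [:: 5; 0; 1; 3; 9; 10] (Embed [:: 0; 4; 8] 1
  [:: 0; 4; 2; 1; 3; 5] (Embed [:: 1; 2; 7] 1 [:: 0; 5; 4; 2; 1; 3] (Embed [:: 0; 7] 0
  [:: 2; 7; 9; 3; 1; 0; 8] (Embed [:: 0; 3; 6] 1 [:: 0; 5; 3; 1; 2; 4] (Embed [:: 1; 4; 5] 1
  [:: 0; 3; 1; 2; 4; 5] (Embed [:: 0; 4; 5] 1 [:: 4; 0; 1; 2; 7; 6] (Embed [:: 1; 4] 1
  [:: 0; 3; 1; 2; 4; 5] (Embed [:: 2; 3] 1 [:: 0; 2; 1; 3; 5; 4] (Embed [:: 1; 2] 1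
  [:: 0; 5; 4; 2; 1; 3] (Split [:: 4; 8] (Embed [:: 0; 4; 7] 0 [:: 0; 1; 11; 7; 8; 9; 10] (Embed
  [:: 0; 2] 0 [:: 0; 1; 4; 2; 3; 5; 6] (Recolor [:: 0]))) (Embed [:: 3; 6] 0
  [:: 0; 1; 3; 2; 5; 4; 10; 9; 8; 7; 6] (Embed [:: 2; 9] 0 [:: 0; 8; 7; 9; 6; 10; 4; 2; 1; 3; 5]
  (Embed [:: 1; 5] 0 [:: 0; 8; 9; 7; 10; 6; 5; 3; 1; 2; 4] (Split [:: 8] (Recolor [:: 0]) (Embed
  [:: 6] 0 [:: 0; 1; 3; 2; 5; 4; 10; 9; 8; 7; 6] (Embed [:: 2] 0
  [:: 0; 8; 7; 9; 6; 10; 4; 2; 1; 3; 5] (Embed [:: 1] 0 [:: 0; 8; 9; 7; 10; 6; 5; 3; 1; 2; 4]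
  (Recolor [:: 0; 1; 2; 3; 4; 5; 6; 7; 8; 9])))))))))))))))))))) (Split [:: 0; 1; 6] (Embed
  [:: 2; 3; 9] 2 [:: 0; 2; 1; 3; 5; 4] (Embed [:: 0; 3; 9] 1 [:: 1; 0; 6; 7; 8; 9; 10] (Embed
  [:: 0; 9] 1 [:: 1; 0; 6; 7; 8; 9; 10] (Embed [:: 0; 4; 8] 2 [:: 0; 4; 2; 1; 3; 5] (Embed
  [:: 1; 2; 7] 2 [:: 0; 5; 4; 2; 1; 3] (Embed [:: 0; 3; 6] 2 [:: 0; 5; 3; 1; 2; 4] (Embed
  [:: 1; 4; 5] 2 [:: 0; 3; 1; 2; 4; 5] (Embed [:: 0; 4; 5] 1 [:: 0; 1; 9; 10; 6; 7; 8] (Embed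
  [:: 0; 5] 1 [:: 0; 1; 9; 10; 6; 7; 8] (Embed [:: 1; 4] 0 [:: 0; 2; 5; 1; 3; 8; 7; 6; 10; 9]
  (Embed [:: 0; 4] 0 [:: 0; 5; 1; 4; 2; 6; 10; 9; 8; 7] (Embed [:: 2; 3] 0
  [:: 0; 4; 3; 2; 1; 7; 6; 10; 9; 8] (Embed [:: 0; 3] 0 [:: 0; 1; 4; 3; 5; 9; 8; 7; 6; 10] (Split
  [:: 4; 8] (Embed [:: 0; 2; 8] 1 [:: 0; 1; 4; 2; 3; 5; 6] (Embed [:: 0; 4; 7] 1
  [:: 0; 1; 11; 7; 8; 9; 10] (Embed [:: 0; 1; 7] 1 [:: 0; 1; 11; 7; 8; 9; 10] (Embed [:: 0; 2; 6]
  1 [:: 0; 1; 9; 8; 7; 11; 10] (Embed [:: 0; 6] 1 [:: 0; 1; 9; 8; 7; 11; 10] (Embed [:: 0; 1] 1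
  [:: 0; 1; 5; 3; 2; 4; 6] (Recolor [:: 0]))))))) (Embed [:: 4; 5] 0
  [:: 0; 2; 1; 4; 3; 5; 9; 8; 7; 6; 10] (Embed [:: 3; 9] 0 [:: 0; 3; 1; 5; 2; 4; 7; 8; 9; 10; 6]
  (Embed [:: 3; 6] 0 [:: 0; 1; 3; 2; 5; 4; 10; 9; 8; 7; 6] (Embed [:: 2; 9] 0
  [:: 0; 4; 2; 5; 1; 3; 8; 7; 6; 10; 9] (Embed [:: 2; 7] 0 [:: 0; 2; 4; 1; 5; 3; 10; 6; 7; 8; 9]
  (Embed [:: 1; 7] 0 [:: 0; 3; 5; 1; 4; 2; 6; 10; 9; 8; 7] (Embed [:: 1; 5] 0
  [:: 0; 5; 3; 4; 1; 2; 8; 9; 10; 6; 7] (Embed [:: 0; 8] 0 [:: 0; 5; 4; 3; 2; 1; 7; 6; 10; 9; 8]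
  (Embed [:: 0; 6] 0 [:: 0; 4; 5; 2; 3; 1; 9; 10; 6; 7; 8] (Split [:: 9] (Recolor [:: 0]) (Embed
  [:: 8] 0 [:: 0; 4; 2; 5; 1; 3; 8; 7; 6; 10; 9] (Embed [:: 7] 0
  [:: 0; 5; 4; 3; 2; 1; 7; 6; 10; 9; 8] (Embed [:: 6] 0 [:: 0; 3; 5; 1; 4; 2; 6; 10; 9; 8; 7]
  (Embed [:: 5] 0 [:: 0; 3; 1; 5; 2; 4; 7; 8; 9; 10; 6] (Embed [:: 4] 0
  [:: 0; 7; 8; 6; 9; 10; 3; 1; 2; 4; 5] (Embed [:: 3] 0 [:: 0; 9; 8; 10; 7; 6; 2; 1; 3; 5; 4]
  (Embed [:: 2] 0 [:: 0; 6; 7; 10; 8; 9; 1; 2; 4; 5; 3] (Embed [:: 1] 0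
  [:: 0; 10; 9; 6; 8; 7; 1; 3; 5; 4; 2] (Embed [:: 0] 0 [:: 0; 10; 6; 9; 7; 8; 2; 4; 5; 3; 1]
  (Recolor [:: 0; 1; 2; 3; 4; 5; 6; 7; 8; 9])))))))))))))))))))))))))))))))))) (Split [:: 1; 6]
  (Embed [:: 0; 3; 6] 0 [:: 1; 0; 3; 4; 5; 6; 7; 8; 9; 10] (Split [:: 0; 1] (Recolor [:: 4])
  (Split [:: 0; 1; 4] (Recolor [:: 4]) (Recolor [:: 1])))) (Split [:: 1; 2] (Embed [:: 0; 9] 3
  [:: 3; 9; 6; 4; 1; 0; 10] (Embed [:: 0; 1; 7] 0 [:: 3; 0; 5; 2; 4; 7; 8; 9; 10; 6] (Embed
  [:: 0; 6] 4 [:: 2; 0; 1; 4; 6; 7] (Recolor [:: 0])))) (Split [:: 1] (Recolor [:: 1]) (Recolor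
  [:: 1])))))))))) (Split [:: 0; 1] (Embed [:: 0; 8] 1 [:: 2; 8; 5; 3; 1; 0; 9] (Split [:: 0; 6]
  (Embed [:: 0; 4; 8] 0 [:: 1; 4; 0; 5; 9; 8; 7; 6; 10] (Recolor [:: 4])) (Embed [:: 0; 5] 0
  [:: 0; 1; 3; 2; 4; 8; 7; 6; 5; 9] (Recolor [:: 0])))) (Split [:: 1] (Embed [:: 0; 1; 6] 1
  [:: 0; 3; 2; 4; 8; 7; 6; 5; 9] (Embed [:: 1; 6] 1 [:: 0; 3; 2; 4; 8; 7; 6; 5; 9] (Recolor
  [:: 1]))) (Recolor [:: 1]))))))) (Split [:: 1] (Embed [:: 0; 1; 4] 0 [:: 3; 0; 2; 5; 6; 7; 8; 4]
  (Embed [:: 1; 4] 0 [:: 3; 0; 2; 5; 6; 7; 8; 4] (Embed [:: 0; 3] 2 [:: 2; 0; 1; 3; 8; 4] (Split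
  [:: 0; 1] (Embed [:: 0; 8] 2 [:: 4; 0; 1; 3; 5; 9] (Embed [:: 1; 7] 0
  [:: 5; 1; 3; 2; 0; 8; 9; 4] (Embed [:: 0; 5] 0 [:: 9; 2; 4; 1; 0; 6; 5; 3] (Split [:: 1; 6]
  (Split [:: 1; 7] (Embed [:: 0; 5] 1 [:: 0; 6; 2; 9; 1; 3; 4] (Recolor [:: 5])) (Recolor [:: 1]))
  (Recolor [:: 1]))))) (Split [:: 1] (Embed [:: 0; 8] 3 [:: 4; 0; 1; 3; 5; 9] (Embed [:: 0; 3] 0
  [:: 1; 0; 3; 4; 5; 6; 7; 8; 9] (Split [:: 0; 1; 6] (Embed [:: 2; 3; 9] 3 [:: 0; 2; 1; 3; 5; 4]
  (Embed [:: 0; 3; 9] 1 [:: 6; 2; 4; 1; 8; 9; 10; 0] (Embed [:: 0; 9] 2 [:: 1; 0; 6; 7; 8; 9; 10]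
  (Embed [:: 1; 2; 7] 3 [:: 0; 5; 4; 2; 1; 3] (Embed [:: 1; 4; 5] 3 [:: 0; 3; 1; 2; 4; 5] (Embed
  [:: 0; 4; 5] 1 [:: 10; 3; 5; 1; 8; 7; 6; 0] (Embed [:: 0; 5] 2 [:: 0; 1; 9; 10; 6; 7; 8] (Embed
  [:: 0; 4] 3 [:: 0; 4; 2; 1; 3; 5] (Embed [:: 0; 3] 3 [:: 0; 5; 3; 1; 2; 4] (Split [:: 4; 5]
  (Embed [:: 0; 8] 2 [:: 1; 0; 10; 11; 7; 8; 9] (Embed [:: 0; 1] 2 [:: 0; 1; 5; 3; 2; 4; 6]
  (Recolor [:: 0]))) (Embed [:: 3; 9] 0 [:: 0; 1; 3; 2; 5; 4; 10; 9; 8; 7; 6] (Split [:: 7]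
  (Recolor [:: 0]) (Embed [:: 0] 0 [:: 0; 8; 7; 9; 6; 10; 4; 2; 1; 3; 5] (Recolor
  [:: 0; 1; 2; 3; 4; 5; 6; 7; 8; 9])))))))))))))) (Recolor [:: 0])))) (Recolor [:: 1]))))))
  (Recolor [:: 1]))))) (Split [:: 0] (Embed [:: 1; 5] 0 [:: 0; 2; 6; 5; 4; 3; 7] (Split [:: 0; 5]
  (Embed [:: 1; 7] 2 [:: 0; 7; 1; 2; 3; 8] (Embed [:: 1; 6] 2 [:: 0; 8; 3; 2; 1; 7] (Embed
  [:: 1; 5] 1 [:: 0; 6; 8; 3; 2; 1; 7] (Embed [:: 0; 4] 1 [:: 0; 1; 8; 4; 5; 6; 7] (Embed
  [:: 1; 3] 1 [:: 0; 4; 7; 1; 2; 3; 8] (Embed [:: 0; 3] 1 [:: 0; 4; 3; 2; 1; 7; 8] (Split [:: 4]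
  (Embed [:: 0; 2] 9 [:: 1; 0; 7; 6; 5; 4; 3; 2; 8; 9] (Recolor [:: 0])) (Recolor
  [:: 3; 4; 5])))))))) (Embed [:: 0; 2] 0 [:: 0; 1; 2; 6; 5; 4; 3; 7] (Split [:: 0; 4] (Embed
  [:: 0; 7] 2 [:: 1; 0; 4; 5; 6; 7; 8] (Embed [:: 1; 4] 0 [:: 0; 2; 1; 7; 8; 4; 5; 6] (Embed
  [:: 0; 4] 1 [:: 0; 1; 5; 4; 8; 7; 6] (Embed [:: 0; 3] 2 [:: 0; 1; 7; 8; 4; 5; 6] (Split
  [:: 1; 7] (Embed [:: 0; 6] 1 [:: 3; 4; 1; 0; 7; 8; 9] (Embed [:: 0; 5] 1
  [:: 3; 4; 1; 0; 6; 5; 9] (Split [:: 1; 3] (Embed [:: 0; 1] 3 [:: 4; 1; 0; 2; 10; 5] (Split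
  [:: 1; 2] (Split [:: 1; 10] (Split [:: 1; 11] (Recolor [:: 1]) (Recolor [:: 1])) (Recolor
  [:: 1])) (Recolor [:: 1]))) (Split [:: 3] (Embed [:: 0; 1; 2] 0
  [:: 0; 5; 3; 4; 2; 6; 7; 8; 9; 10] (Recolor [:: 0])) (Recolor [:: 3]))))) (Split [:: 0; 2]
  (Embed [:: 0; 8] 0 [:: 0; 2; 1; 4; 5; 6; 7; 8; 9] (Embed [:: 2; 6] 0
  [:: 0; 4; 3; 2; 6; 5; 9; 8; 7] (Embed [:: 0; 6] 0 [:: 0; 4; 1; 2; 6; 5; 9; 8; 7] (Split [:: 2]
  (Recolor [:: 0]) (Recolor [:: 2]))))) (Split [:: 2] (Embed [:: 0; 2; 6] 0
  [:: 1; 0; 3; 4; 5; 6; 7; 8; 9] (Embed [:: 2; 6] 1 [:: 0; 4; 3; 2; 6; 5; 9; 8; 7] (Split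
  [:: 0; 1] (Embed [:: 0; 9] 4 [:: 0; 10; 4; 3; 1; 2; 5] (Embed [:: 1; 7] 4
  [:: 0; 8; 4; 5; 2; 1; 3] (Embed [:: 0; 4] 5 [:: 0; 4; 3; 1; 2; 5] (Embed [:: 1; 2] 5
  [:: 0; 4; 5; 2; 1; 3] (Split [:: 8] (Recolor [:: 0]) (Embed [:: 3] 0
  [:: 0; 7; 6; 8; 9; 10; 2; 1; 3; 4; 5] (Recolor [:: 0; 1; 2; 3; 4; 5; 6; 7; 8; 9]))))))) (Split
  [:: 2] (Embed [:: 0; 1; 7] 0 [:: 1; 4; 0; 2; 5; 6; 7; 8; 9; 10] (Recolor [:: 1])) (Recolor
  [:: 1; 2]))))) (Split [:: 1] (Embed [:: 2; 6] 2 [:: 0; 4; 3; 2; 6; 5; 9; 8; 7] (Embed [:: 1] 0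
  [:: 0; 4; 3; 2; 6; 5; 9; 8; 7] (Split [:: 0; 8] (Embed [:: 1; 9] 6 [:: 0; 5; 4; 2; 1; 10] (Embed
  [:: 8] 0 [:: 0; 3; 8; 9; 1; 2; 4; 5; 10] (Embed [:: 1; 7] 3 [:: 0; 8; 3; 5; 10; 1; 2; 4] (Embed
  [:: 0; 3] 6 [:: 0; 5; 10; 1; 2; 4] (Recolor [:: 0; 1; 2; 3; 4; 5; 6; 7; 8; 9]))))) (Embed
  [:: 0; 6] 0 [:: 0; 1; 4; 3; 2; 6; 5; 9; 8; 7] (Recolor [:: 0]))))) (Recolor [:: 1; 2])))))))))
  (Embed [:: 0; 3] 0 [:: 0; 1; 2; 6; 5; 4; 3; 7] (Split [:: 0; 6] (Split [:: 2] (Split [:: 2]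
  (Embed [:: 0; 1; 9] 4 [:: 3; 0; 1; 4; 5; 10] (Embed [:: 0; 9] 4 [:: 3; 0; 1; 4; 5; 10] (Recolor
  [:: 0]))) (Recolor [:: 2])) (Recolor [:: 2])) (Split [:: 0] (Split [:: 0; 7] (Embed [:: 1; 6] 1
  [:: 0; 2; 1; 5; 6; 7; 8; 9] (Embed [:: 1; 5] 1 [:: 0; 2; 1; 8; 7; 6; 5; 9] (Split [:: 7] (Embed
  [:: 0; 5] 4 [:: 0; 1; 8; 7; 6; 10; 9] (Split [:: 0] (Embed [:: 0; 10] 2
  [:: 2; 1; 0; 7; 8; 9; 10; 11] (Recolor [:: 0])) (Recolor [:: 0]))) (Recolor [:: 5; 6; 7]))))
  (Split [:: 0; 5] (Embed [:: 1; 5] 3 [:: 0; 2; 1; 8; 9; 5; 6; 7] (Embed [:: 0; 3] 2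
  [:: 1; 0; 4; 5; 6; 7; 8; 9] (Split [:: 1; 3] (Recolor [:: 3]) (Embed [:: 0; 2] 0
  [:: 0; 4; 3; 2; 1; 6; 5; 9; 8; 7] (Recolor [:: 1; 2; 3]))))) (Embed [:: 0; 4] 0
  [:: 0; 1; 2; 3; 7; 6; 5; 4; 8] (Recolor [:: 0])))) (Recolor [:: 0])))))))) (Recolor [:: 0])))))
  (Embed [:: 3] 0 [:: 0; 5; 1; 2; 3; 4] (Embed [:: 0] 0 [:: 0; 2; 3; 4; 5; 1] (Recolor
  [:: 0; 3; 4])))))))).

(** Index 0 is initially the 5-cycle, already refuted: the opening entries discard the types that
    would create one. *)
Definition C7_cert : cert :=
  Embed [:: 2; 4; 6] 0 [:: 0; 3; 2; 1; 7] (Embed [:: 1; 4; 6] 0 [:: 0; 2; 3; 4; 5] (Embed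
  [:: 1; 3; 6] 0 [:: 0; 4; 5; 6; 7] (Embed [:: 3; 6] 0 [:: 0; 4; 5; 6; 7] (Embed [:: 2; 6] 0
  [:: 0; 3; 2; 1; 7] (Embed [:: 1; 3; 5] 0 [:: 1; 2; 0; 6; 7] (Embed [:: 0; 3; 5] 0
  [:: 0; 1; 2; 3; 4] (Embed [:: 0; 2; 5] 0 [:: 0; 3; 4; 5; 6] (Embed [:: 2; 5] 0
  [:: 0; 3; 4; 5; 6] (Embed [:: 1; 5] 0 [:: 1; 2; 0; 6; 7] (Embed [:: 0; 2; 4] 0
  [:: 1; 0; 5; 6; 7] (Embed [:: 1; 4] 0 [:: 0; 2; 3; 4; 5] (Embed [:: 0; 4] 0 [:: 1; 0; 5; 6; 7]
  (Embed [:: 0; 3] 0 [:: 0; 1; 2; 3; 4] (Split [:: 4; 6] (Embed [:: 0; 2; 4] 0 [:: 1; 0; 3; 2; 8]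
  (Embed [:: 0; 1; 3] 0 [:: 1; 0; 4; 5; 6] (Embed [:: 0; 3] 0 [:: 1; 0; 4; 5; 6] (Embed [:: 0; 2]
  0 [:: 1; 0; 3; 2; 8] (Split [:: 4; 6] (Embed [:: 0; 2; 4] 0 [:: 3; 0; 1; 8; 9] (Embed
  [:: 0; 1; 2] 0 [:: 3; 0; 1; 8; 9] (Embed [:: 0; 1] 0 [:: 2; 0; 1; 8; 9] (Split [:: 1; 5] (Split
  [:: 1; 9] (Split [:: 1; 10] (Recolor [:: 1]) (Recolor [:: 1])) (Recolor [:: 1])) (Recolor
  [:: 1]))))) (Embed [:: 1; 6] 0 [:: 0; 1; 5; 4; 3; 2; 8; 7; 6] (Split [:: 6] (Embed [:: 0; 4; 6]
  0 [:: 1; 2; 3; 4; 5; 0; 7; 8; 9] (Embed [:: 0; 3; 5] 1 [:: 1; 0; 6; 7; 8] (Embed [:: 0; 1; 5] 0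
  [:: 0; 8; 3; 4; 5; 6; 7; 2; 9] (Embed [:: 0; 2; 4] 1 [:: 3; 0; 1; 8; 9] (Embed [:: 0; 1; 2] 0
  [:: 0; 8; 6; 5; 4; 3; 9; 2; 7] (Recolor [:: 0])))))) (Recolor [:: 6])))))))) (Embed [:: 3; 5] 0
  [:: 0; 7; 1; 2; 3; 4; 5; 6] (Embed [:: 1; 6] 0 [:: 0; 6; 5; 4; 3; 2; 1; 7] (Embed [:: 0; 5] 0
  [:: 0; 5; 4; 3; 2; 1; 7; 6] (Embed [:: 0; 2] 0 [:: 0; 4; 5; 6; 7; 1; 2; 3] (Split [:: 6] (Embed
  [:: 0; 3; 5] 0 [:: 0; 7; 8; 2; 3; 4; 5; 6] (Embed [:: 0; 5] 1 [:: 1; 0; 6; 7; 8] (Embed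
  [:: 0; 2; 4] 0 [:: 0; 6; 7; 8; 2; 3; 4; 5] (Embed [:: 0; 2] 1 [:: 1; 0; 3; 2; 8] (Split
  [:: 0; 4] (Embed [:: 0; 7] 1 [:: 2; 1; 0; 8; 9] (Recolor [:: 6; 7])) (Embed [:: 0; 3] 0
  [:: 0; 1; 7; 6; 5; 4; 3; 2; 8] (Recolor [:: 0]))))))) (Embed [:: 5] 0
  [:: 0; 5; 4; 3; 2; 1; 7; 6] (Embed [:: 0] 0 [:: 0; 2; 3; 4; 5; 6; 7; 1] (Recolor
  [:: 0; 5; 6])))))))))))))))))))))).

(** * Verification of the data and the classification *)

Lemma C5_cert_ok :
  check (cycle_code 5) (all_types (cycle_code 5)) obstruction_codes C5_cert.
Proof. by vm_compute. Qed.

Lemma C7_cert_ok :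
  check (cycle_code 7) (all_types (cycle_code 7)) (cycle_code 5 :: obstruction_codes) C7_cert.
Proof. by vm_compute. Qed.

Lemma obstruction_codes_ok :
  all (fun X => [&& embeds_at X X (iota 0 (size X)), is_minimal_code X
                  & ~~ extends_path X 8 [::]]) obstruction_codes.
Proof. by vm_compute. Qed.

(** A numerical invariant replaces the search for isomorphisms between all pairs of listed
    graphs. *)
Lemma obstruction_codes_closed_walks :
  uniq [seq code_closed_walks 6 X | X <- obstruction_codes].
Proof. by vm_compute. Qed.

(** A copy has as many vertices as its code, so finitely many tuples decide [avoids]. The
    classification can thus split, without classical axioms, on whether [G] contains a listed
    graph. *)
Lemma avoidsP (G : sgraph) X :
  reflect (avoids G X) [forall t : (size X).-tuple G, ~~ is_copy X t].
Proof.
apply: (iffP forallP) => [noX xs|noX t]; last exact: noX.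
apply/negP => Xxs; have sz : size xs == size X by rewrite (is_copy_size Xxs).
by have := noX (Tuple sz); rewrite Xxs.
Qed.

Lemma avoids_obstructions_colorable (G : sgraph) :
  free (path_graph 8) G ->
  (forall S : {set G}, S \proper [set: G] -> colorable C5 (induced S)) ->
  {in obstruction_codes, forall X, avoids G X} -> ~ ~ colorable C5 G.
Proof.
move=> /free_path_avoids noP G_min noFs G_nc.
(* The triangle is the first listed graph, with the same code. *)
have no3 : avoids G (cycle_code 3) by apply: noFs; vm_compute.
have no_tri (x y z : G) : edge x y -> edge y z -> edge x z -> False.
  move=> xy yz xz; have /negP := no3 [:: x; y; z]; apply.
  rewrite /is_copy /= !inE negb_or xy yz xz eqxx !andbT.
  have ne (u v : G) : edge u v -> u != v by apply: contraTneq => ->; rewrite edge_irrefl.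
  by rewrite !ne.
have all_ok X := complete_all_types noP no_tri X.
have no5 : avoids G (cycle_code 5).
  exact: (check_sound noP no_tri G_nc G_min (all_ok _) noFs C5_cert_ok).
have no7 : avoids G (cycle_code 7).
  apply: (check_sound noP no_tri G_nc G_min (all_ok _) _ C7_cert_ok) => F.
  by rewrite inE => /predU1P [->|/noFs].
have [X X_in [xs Xxs]] := short_odd_cycle G_nc; have : avoids G X.
  by move: X_in; rewrite !inE => /or4P [] /eqP ->.
by move/(_ xs); rewrite Xxs.
Qed.

Theorem theorem1 :
  exists s : 'I_19 -> sgraph,
    (forall i : 'I_19,
       free (path_graph 8) (s i) /\ minimal_obstruction C5 (s i)) /\
    (forall i j : 'I_19, isomorphic (s i) (s j) -> i = j) /\
    (forall G : sgraph,
       free (path_graph 8) G -> minimal_obstruction C5 G ->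
       exists i : 'I_19, isomorphic G (s i)).
Proof.
have codes_ok := allP obstruction_codes_ok.
exists (fun i => code_graph (nth [::] obstruction_codes i)); split=> [i|].
  have /codes_ok /and3P [wf Xmin noP] := mem_nth [::] (ltn_ord i : i < size obstruction_codes).
  split; first exact/avoids_free_path/code_graph_avoids_path.
  exact: is_minimal_code_obstruction.
split=> [i j /(isomorphic_closed_walks 6)|G G_free [G_nc G_min]].
  rewrite -!code_closed_walksE -!(nth_map [::] 0) // => /eqP.
  by rewrite nth_uniq ?size_map ?obstruction_codes_closed_walks // => /eqP /val_inj.
have [/allP noFs|] := boolP (all (fun X => [forall t : (size X).-tuple G, ~~ is_copy X t])
    obstruction_codes).
  case: (avoids_obstructions_colorable G_free G_min _ G_nc) => X /noFs /avoidsP.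
  exact.
case/allPn=> X X_in; rewrite negb_forall => /existsP [t]; rewrite negbK => Xt.
have lti : index X obstruction_codes < 19 by rewrite (_ : 19 = size obstruction_codes) // index_mem.
exists (Ordinal lti); rewrite /= nth_index //.
have /and3P [_ /andP [noc _] _] := codes_ok _ X_in.
(* By minimality the copy contains every vertex, so the identity of [G] has the copy as its
   image. *)
apply: (@copy_isomorphic G G id _ _ Xt) => // x.
by rewrite (copy_minimal_full noc Xt G_min); apply/esym/codomP; exists x.
Qed.
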